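(* Let $k>0$ be an integer. Let $[\cdot,\cdot]$ be an indefinite scalar product on $\mathbb{R}^n$, given by $[x,y]=(Hx,y)$ with $H$ a nonsingular real symmetric operator, such that the space has rank $k$, and let $N$ be an indecomposable $H$-normal operator on $\mathbb{R}^n$. Then one of the following holds, where the eigenvalues listed are all the distinct complex eigenvalues of $N$: (A) $N$ has only one eigenvalue, it is real, and $2k\le n\le 4k$; (B) $N$ has only two distinct eigenvalues, both real, and $n=2k$; (C) $N$ has only two eigenvalues, which are non-real and complex conjugate to each other, and $n=2$ if $k=1$, while $2k\le n\le 10[k/2]-2$ if $k>1$; (D) $N$ has only one real eigenvalue and one pair of non-real complex conjugate eigenvalues, and $n=2k$; (E) $N$ has only two distinct pairs of non-real complex conjugate eigenvalues, and $n=2k$. The alternatives (D) and (E) are possible only if $k$ is even. Moreover, the estimates (A), (B), (D), (E) and the lower bound in (C) are strict (i.e. attained). That is, in each of the following situations there exist a nonsingular real symmetric $H$ on $\mathbb{R}^n$ for which the space has rank $k$ and an indecomposable $H$-normal operator $N$ on $\mathbb{R}^n$ whose set of eigenvalues is of the indicated type: - type (A), for every $k>0$, both for $n=2k$ and for $n=4k$; - type (B), for every $k>0$ and $n=2k$; - type (C), for every $k>0$ and $n=2k$; - type (D), for every even $k>0$ and $n=2k$; - type (E), for every even $k>0$ and $n=2k$.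
   Context: Let $(\cdot,\cdot)$ be the standard inner product on $\mathbb{R}^n$. An indefinite scalar product on $\mathbb{R}^n$ is a nondegenerate symmetric bilinear form $[\cdot,\cdot]$; it can be written $[x,y]=(Hx,y)$ for a unique nonsingular symmetric operator $H$. The rank of the space is $\min\{v_-,v_+\}$, where $v_-$ (resp. $v_+$) is the number of negative (resp. positive) eigenvalues of $H$, counted with multiplicity. For a linear operator $A$ on $\mathbb{R}^n$, the $H$-adjoint $A^{[*]}$ is defined by $[A^{[*]}x,y]=[x,Ay]$ for all $x,y$. An operator $N$ is $H$-normal if $NN^{[*]}=N^{[*]}N$. The eigenvalues of an operator on $\mathbb{R}^n$ are the complex roots of its characteristic polynomial (eigenvalues of its complexification). For a subspace $V$, $V^{[\perp]}=\{x : [x,y]=0 \ \forall y\in V\}$. A nonzero subspace $V$ is nondegenerate if $x\in V$ and $[x,y]=0$ for all $y\in V$ imply $x=0$. A linear operator $A$ on $\mathbb{R}^n$ is decomposable if there is a nondegenerate proper nonzero (real) subspace $V$ such that both $V$ and $V^{[\perp]}$ are invariant under $A$ (equivalently, $V$ is invariant under both $A$ and $A^{[*]}$). Otherwise $A$ is indecomposable. $[k/2]$ denotes the integer part of $k/2$. *)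

(* Defs.v *)
From mathcomp Require Import all_boot all_order all_algebra.
From mathcomp Require Import polyrcf complex.
From mathcomp Require Import reals.

Set Implicit Arguments.
Unset Strict Implicit.
Unset Printing Implicit Defensive.

Import Order.TTheory GRing.Theory Num.Theory.

Local Open Scope ring_scope.
Local Open Scope complex_scope.

(* R is the field of real numbers (a [realType] is a complete ordered field).
   Vectors of R^n are row vectors, an n x n matrix A is the operator
   x |-> x *m A, and a subspace is the row space of a matrix V : 'M[R]_n. *)
Section IndefiniteScalarProduct.
Variables (R : realType) (n : nat).
Implicit Types (H A B N V : 'M[R]_n) (x y : 'rV[R]_n).

Definition dotv x y : R := (x *m y^T) 0 0.

Definition sprod H x y : R := dotv (x *m H) y.

Definition nonsingular_symmetric H : Prop := H^T = H /\ H \in unitmx.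

(* Algebraic multiplicities; all the roots of [char_poly H] are real when H is
   symmetric. *)
Definition num_neg_eigenvalues H : nat :=
  (\sum_(a <- rootsR (char_poly H) | (a < 0)%R) mup a (char_poly H))%N.

Definition num_pos_eigenvalues H : nat :=
  (\sum_(a <- rootsR (char_poly H) | (0 < a)%R) mup a (char_poly H))%N.

Definition space_rank H : nat :=
  minn (num_neg_eigenvalues H) (num_pos_eigenvalues H).

(* B is the H-adjoint of A; it exists and is unique for nonsingular symmetric H,
   see [is_adjointE]. *)
Definition is_adjoint H A B : Prop :=
  forall x y, sprod H (x *m B) y = sprod H x (y *m A).

Definition Hnormal H N : Prop :=
  exists2 M : 'M[R]_n, is_adjoint H N M & N *m M = M *m N.

Definition in_perp H V x : Prop :=
  forall y, (y <= V)%MS -> sprod H x y = 0.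

Definition nondegenerate H V : Prop :=
  V != 0 /\ forall x, (x <= V)%MS -> in_perp H V x -> x = 0.

Definition decomposable H A : Prop :=
  exists V : 'M[R]_n,
    [/\ nondegenerate H V, ~~ row_full V, stablemx V A
      & forall x, in_perp H V x -> in_perp H V (x *m A)].

Definition indecomposable H A : Prop := ~ decomposable H A.

Lemma is_adjointE H A B : nonsingular_symmetric H ->
  is_adjoint H A B <-> B = H *m A^T *m invmx H.
Proof.
case=> _ Hu; split=> [adj | -> x y]; last first.
  by rewrite /sprod /dotv trmx_mul !mulmxA mulmxKV.
suff: B *m H = H *m A^T by move=> <-; rewrite mulmxK.
apply/matrixP=> i j; have := adj (delta_mx 0 i) (delta_mx 0 j).
rewrite /sprod /dotv !trmx_mul trmx_delta !mulmxA -!(mulmxA (delta_mx 0 i)).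
by rewrite -!rowE -!colE !mxE.
Qed.

End IndefiniteScalarProduct.

Section SpectralTypes.
Variables (R : realType) (n : nat).
Implicit Types (N : 'M[R]_n) (a b : R) (l m : R[i]).

Definition complex_eigenvalues N : pred R[i] :=
  root (map_poly (real_complex R) (char_poly N)).

Definition nonreal (z : R[i]) : bool := complex.Im z != 0.

Definition one_real_eigenvalue N : Prop :=
  exists a, complex_eigenvalues N =i [:: a%:C].

Definition two_real_eigenvalues N : Prop :=
  exists a b, a != b /\ complex_eigenvalues N =i [:: a%:C; b%:C].

Definition one_nonreal_pair N : Prop :=
  exists l, nonreal l /\ complex_eigenvalues N =i [:: l; conjc l].

Definition one_real_one_nonreal_pair N : Prop :=
  exists a l,
    nonreal l /\ complex_eigenvalues N =i [:: a%:C; l; conjc l].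

Definition two_nonreal_pairs N : Prop :=
  exists l m,
    [/\ nonreal l, nonreal m, m != l, m != conjc l
      & complex_eigenvalues N =i [:: l; conjc l; m; conjc m]].

End SpectralTypes.

Section Attained.
Variables (R : realType).

Definition indecomposable_normal (k n : nat) (H N : 'M[R]_n) : Prop :=
  [/\ nonsingular_symmetric H, space_rank H = k, Hnormal H N
    & indecomposable H N].

Definition attained (k n : nat) (T : 'M[R]_n -> Prop) : Prop :=
  exists H N : 'M[R]_n, indecomposable_normal k H N /\ T N.

End Attained.

(* Main.v *)
Require Import Defs.
From mathcomp Require Import all_boot all_order all_algebra.
From mathcomp Require Import polyrcf complex.
From mathcomp Require Import boolp reals.
From mathcomp Require Import ring lra zify.

(* Let M be the H-adjoint of N.  A decomposition of the space amounts to a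
   nontrivial self-adjoint idempotent commuting with N, so every idempotent E
   that is a polynomial in N satisfies E E* = 0 or E E* = 1.  Applied to the
   spectral idempotents of N this leaves at most two primary components over R;
   if there are two, E + E* = 1, both components are isotropic and n = 2k.

   If the minimal polynomial is a power of the irreducible polynomial of a
   nonreal l, let J be the polynomial in N with J^2 = -1 and
   N = Re l + Im l J + nilpotent.  Then J J* = 1 or -1.  If J J* = -1 then J*
   = J exchanges the signs of the form, so n = 2k.  If J J* = 1, or if N has
   one real eigenvalue (J := 1), let L be a maximal isotropic subspace invariant
   under J and under the nilpotent parts A, A*.  Both A and A* map the
   orthogonal complement of L into L, and their joint kernel in it lies in L, so
   n - dim L <= 2 dim L + dim L; moreover dim L <= k, and dim L is even when J^2
   = -1.

   The examples with n = 2k are a companion matrix with a Hankel form, and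
   diag (X, c X^T) with a hyperbolic form, X being a companion matrix. *)

Set Implicit Arguments.
Unset Strict Implicit.
Unset Printing Implicit Defensive.

Import Order.TTheory GRing.Theory Num.Theory.

Local Open Scope ring_scope.

(** * Forms and inertia *)

Section Form.
Variables (R : realType) (n : nat).
Implicit Types (H A B U V W : 'M[R]_n) (x y z : 'rV[R]_n) (a : R).

Lemma sprodE H x y : sprod H x y = (x *m H *m y^T) 0 0.
Proof. by []. Qed.

Lemma sprodDl H x y z : sprod H (x + y) z = sprod H x z + sprod H y z.
Proof. by rewrite !sprodE !mulmxDl mxE. Qed.

Lemma sprodDr H x y z : sprod H x (y + z) = sprod H x y + sprod H x z.
Proof. by rewrite !sprodE linearD mulmxDr mxE. Qed.

Lemma sprodZl H a x y : sprod H (a *: x) y = a * sprod H x y.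
Proof. by rewrite !sprodE -!scalemxAl mxE. Qed.

Lemma sprodZr H a x y : sprod H x (a *: y) = a * sprod H x y.
Proof. by rewrite !sprodE linearZ -scalemxAr mxE. Qed.

Lemma sprod0l H x : sprod H 0 x = 0.
Proof. by rewrite sprodE !mul0mx mxE. Qed.

Lemma sprod0r H x : sprod H x 0 = 0.
Proof. by rewrite sprodE trmx0 mulmx0 mxE. Qed.

Lemma sprodC H x y : H^T = H -> sprod H x y = sprod H y x.
Proof.
move=> sH; have tr1 (t : 'M[R]_1) : t 0 0 = t^T 0 0 by rewrite mxE.
by rewrite !sprodE tr1 !trmx_mul trmxK sH mulmxA.
Qed.

Lemma sprod_nondeg H x : H \in unitmx -> (forall y, sprod H x y = 0) -> x = 0.
Proof.
move=> Hu xH0; suff xH : x *m H = 0 by rewrite -(mulmxK Hu x) xH mul0mx.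
apply/rowP=> j; have := xH0 (delta_mx 0 j).
by rewrite sprodE trmx_delta -colE !mxE.
Qed.

Lemma sprod_mx0 (p q : nat) H (U : 'M[R]_(p, n)) (V : 'M[R]_(q, n)) :
  (forall x y, (x <= U)%MS -> (y <= V)%MS -> sprod H x y = 0) <->
  U *m H *m V^T = 0.
Proof.
split=> [UV0 | UV0 x y /submxP[u ->] /submxP[v ->]]; last first.
  by rewrite sprodE trmx_mul !mulmxA -(mulmxA (u *m U)) -(mulmxA u)
    [U *m (H *m _)]mulmxA UV0 mulmx0 mul0mx mxE.
apply/matrixP=> i j; have := UV0 _ _ (row_sub i U) (row_sub j V).
rewrite sprodE -!row_mul tr_row => UV0ij; rewrite [RHS]mxE -[RHS]UV0ij !mxE.
by apply: eq_bigr => k _; rewrite !mxE.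
Qed.

Lemma dotv_ge0 x : 0 <= dotv x x.
Proof. by rewrite /dotv mxE sumr_ge0 // => i _; rewrite mxE -expr2 sqr_ge0. Qed.

Lemma dotv_eq0 x : (dotv x x == 0) = (x == 0).
Proof.
apply/idP/eqP=> [/eqP|->]; last by rewrite /dotv mul0mx mxE.
rewrite /dotv mxE => /eqP; rewrite psumr_eq0; last first.
  by move=> i _; rewrite mxE -expr2 sqr_ge0.
move=> /allP x0; apply/rowP=> j; have := x0 j (mem_index_enum _).
by rewrite !mxE mulf_eq0 orbb => /eqP.
Qed.

Lemma dotv_gt0 x : (0 < dotv x x) = (x != 0).
Proof. by rewrite lt_def dotv_ge0 andbT dotv_eq0. Qed.

End Form.

(** * Spectral theorem, inertia and isotropic subspaces *)

Section Inertia.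
Variables (R : realType) (n : nat).
Implicit Types (H A B U V W : 'M[R]_n) (x y z : 'rV[R]_n) (a : R).

(** Over the complex numbers H is Hermitian, hence unitarily diagonalizable with real eigenvalues;
    [real_similar] descends this similarity to the reals. What survives is an invertible S, with no
    claim of orthogonality. *)
Lemma symmetric_diagonalizable H : H^T = H ->
  exists (e : 'I_n -> R) (S : 'M[R]_n), [/\ S \in unitmx,
    S *m H = diag_mx (\row_i e i) *m S &
    char_poly H = \prod_(i < n) ('X - (e i)%:P)].
Proof.
move=> sH; set f := real_complex R; set HC := map_mx f H.
have rC m (A : 'M[R]_m) : map_mx f A \is a mxOver Num.real.
  by apply/mxOverP=> i j; rewrite mxE; apply/complex_realP; exists (A i j).
have symHC : HC \is symmetricmx.
  apply/is_hermitianmxP; rewrite expr0 scale1r.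
  by apply/matrixP=> i j; rewrite !mxE -[in LHS]sH mxE.
have hHC := realsym_hermsym symHC (rC _ _).
have /orthomx_spectralP dHC := hermitian_normalmx hHC.
pose e i := complex.Re (spectral_diag HC 0 i).
have De : spectral_diag HC = map_mx f (\row_i e i).
  apply/rowP=> i; rewrite !mxE /e /f RRe_real //.
  by have /mxOverP/(_ 0 i) := hermitian_spectral_diag_real hHC.
pose D := diag_mx (\row_i e i); have DD : diag_mx (spectral_diag HC) = map_mx f D.
  by rewrite De map_diag_mx.
have simHD : similar_in unitmx HC (map_mx f D).
  exists (spectralmx HC); first exact: spectral_unit.
  apply/similarP; first exact: spectral_unit.
  by rewrite [X in _ *m X]dHC DD !mulmxA mulmxV ?spectral_unit // mul1mx.
have [T /andP[realT Tu] /(similarP Tu) THD] :=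
  real_similar simHD (rC _ _) (rC _ _).
pose S := map_mx (@complex.Re R) T.
have TS : T = map_mx f S.
  by apply/matrixP=> i j; rewrite !mxE /f RRe_real //; apply: (mxOverP realT).
have Su : S \in unitmx by rewrite -(map_unitmx f) -TS.
have SHD : S *m H = D *m S.
  by apply: (@map_mx_inj _ _ f); rewrite !map_mxM -TS.
exists e, S; split=> //.
have -> : \prod_(i < n) ('X - (e i)%:P) = char_poly D.
  rewrite char_poly_trig ?diag_mx_is_trig //.
  by apply: eq_bigr => i _; rewrite !mxE eqxx mulr1n.
have HSD : H = invmx S *m D *m S by rewrite -mulmxA -SHD mulKmx.
rewrite HSD /char_poly /char_poly_mx.
have -> : 'X%:M - map_mx polyC (invmx S *m D *m S) =
    map_mx polyC (invmx S) *m ('X%:M - map_mx polyC D) *m map_mx polyC S.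
  rewrite mulmxBr mulmxBl -!map_mxM; congr (_ - _).
  by rewrite mul_mx_scalar -scalemxAl -map_mxM mulVmx // map_mx1 scalemx1.
rewrite !det_mulmx mulrC mulrA -det_mulmx -map_mxM mulmxV // map_mx1.
by rewrite det1 mul1r.
Qed.

(** Double counting: the multiplicity of a in the product is the number of indices i with e i = a.
    This turns the eigenvalue counts of the statement into cardinals of index sets. *)
Lemma sum_mup_prod_XsubC (m : nat) (e : 'I_m -> R) (pr : pred R)
    (p := \prod_(i < m) ('X - (e i)%:P)) :
  (\sum_(a <- rootsR p | pr a) mup a p)%N = #|[pred i | pr (e i)]|.
Proof.
have pE : p = \prod_(a <- [seq e i | i <- enum 'I_m]) ('X - a%:P).
  by rewrite big_map big_enum.
have p0 : p != 0 by rewrite pE monic_neq0 ?monic_prod_XsubC.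
have rE i : e i \in rootsR p.
  have -> : (e i \in rootsR p) = root p (e i) by rewrite -(roots_on_rootsR p0).
  rewrite pE root_prod_XsubC.
  by apply: map_f; rewrite mem_enum.
rewrite {2}pE; under eq_bigr do
  rewrite mu_prod_XsubC -sum1_count big_map big_enum_cond.
rewrite (exchange_big_dep predT) //= -sum1_card big_mkcond [RHS]big_mkcond.
apply: eq_bigr => i _ /=; rewrite inE sum1_count.
case: ifP => prei; last first.
  by rewrite (@eq_count _ _ pred0) ?count_pred0 // => a /=; case: eqP => [<-|]; rewrite ?prei ?andbF.
rewrite (@eq_count _ _ (pred1 (e i))) => [|a /=].
  by rewrite count_uniq_mem ?rE // uniq_roots.
by rewrite eq_sym; case: eqP => [->|_]; rewrite ?prei ?andbF.
Qed.

(** V consists of the rows of S whose eigenvalue has the sign of s; s = 1 and s = -1 give the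
    positive and the negative subspace. As S need not be orthogonal, the Gram matrix of these rows
    need not be diagonal; positivity comes from writing s [x, x] as the squared norm of u Dr V,
    where Dr carries the square roots of the s e i. *)
Lemma definite_rows H (e : 'I_n -> R) (S : 'M[R]_n) (s : R) :
    S \in unitmx -> S *m H = diag_mx (\row_i e i) *m S ->
    H^T = H ->
  exists V : 'M[R]_(#|[pred i | 0 < s * e i]|, n), row_free V /\
    forall x, (x <= V)%MS -> x != 0 -> 0 < s * sprod H x x.
Proof.
move=> Su SH sH; set pr := [pred i | _].
pose g (j : 'I_#|pr|) : 'I_n := enum_val j.
have gP j : 0 < s * e (g j) by have := enum_valP j; rewrite inE.
pose V := rowsub g S; exists V.
have Vfree : row_free V.
  apply/row_freeP; exists (invmx S *m colsub g 1%:M).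
  rewrite mulmxA mul_rowsub_mx mulmxV // -mxsub_mul mul1mx.
  by apply/matrixP=> i j; rewrite !mxE (inj_eq enum_val_inj).
split=> // x /submxP[u ->] xn0.
pose r j := Num.sqrt (s * e (g j)); pose Dr := diag_mx (\row_j r j).
have rP j : 0 < r j by rewrite sqrtr_gt0.
pose De := diag_mx (\row_j e (g j)).
have VH : V *m H = De *m V.
  apply/matrixP=> i j; rewrite mul_rowsub_mx SH mxE.
  by rewrite !mul_diag_mx !mxE.
have symG : (De *m (V *m V^T))^T = De *m (V *m V^T).
  by rewrite !mulmxA -VH !trmx_mul trmxK sH mulmxA.
(* The Gram matrix vanishes off the blocks e (g i) = e (g j), where r i * r j is s * e. *)
have GE : s *: (De *m (V *m V^T)) = Dr *m (V *m V^T) *m Dr.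
  have symVV : (V *m V^T)^T = V *m V^T by rewrite trmx_mul trmxK.
  move: (V *m V^T) symG symVV => G symG symVV.
  apply/matrixP=> i j; rewrite mul_mx_diag mul_diag_mx mxE mul_diag_mx !mxE.
  have Gji : G j i = G i j by rewrite -[in RHS]symVV mxE.
  have /matrixP/(_ i j) := symG; rewrite mxE !mul_diag_mx !mxE Gji => /eqP.
  rewrite -subr_eq0 -mulrBl mulf_eq0 subr_eq0 => /orP[/eqP eij | /eqP ->].
    have -> : r i = r j by rewrite /r eij.
    rewrite mulrAC -expr2 sqr_sqrtr; last exact: ltW.
    by rewrite eij mulrA.
  by rewrite !mulr0 mul0r.
have -> : s * sprod H (u *m V) (u *m V) = dotv (u *m Dr *m V) (u *m Dr *m V).
  have -> : sprod H (u *m V) (u *m V) = (u *m (De *m (V *m V^T)) *m u^T) 0 0.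
    by rewrite sprodE trmx_mul -(mulmxA u V H) VH !mulmxA.
  have -> t : s * (u *m t *m u^T) 0 0 = (u *m (s *: t) *m u^T) 0 0.
    by rewrite -scalemxAr -scalemxAl [RHS]mxE.
  by rewrite GE /dotv !trmx_mul tr_diag_mx !mulmxA.
rewrite dotv_gt0; apply: contraNneq xn0 => uDV.
have uD : u *m Dr = 0.
  by apply/eqP; rewrite -(mulmx_free_eq0 _ Vfree) uDV.
suff -> : u = 0 by rewrite mul0mx.
apply/rowP=> j; have /rowP/(_ j) := uD; rewrite mul_mx_diag !mxE => /eqP.
by rewrite mulf_eq0 (gt_eqF (rP j)) orbF => /eqP.
Qed.

Lemma inertia H : nonsingular_symmetric H ->
  (num_neg_eigenvalues H + num_pos_eigenvalues H = n)%N /\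
  exists (P : 'M[R]_(num_pos_eigenvalues H, n))
         (Q : 'M[R]_(num_neg_eigenvalues H, n)),
    [/\ row_free P, row_free Q,
      forall x, (x <= P)%MS -> x != 0 -> 0 < sprod H x x &
      forall x, (x <= Q)%MS -> x != 0 -> sprod H x x < 0].
Proof.
case=> sH Hu; have [e [S [Su SH cH]]] := symmetric_diagonalizable sH.
have posE : num_pos_eigenvalues H = #|[pred i | 0 < 1 * e i]|.
  rewrite /num_pos_eigenvalues cH sum_mup_prod_XsubC.
  by apply: eq_card => i; rewrite !inE mul1r.
have negE : num_neg_eigenvalues H = #|[pred i | 0 < -1 * e i]|.
  rewrite /num_neg_eigenvalues cH sum_mup_prod_XsubC.
  by apply: eq_card => i; rewrite !inE mulN1r oppr_gt0.
have en0 i : e i != 0.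
  apply: contraTneq Hu => ei0; have: row i S *m H = 0.
    by rewrite -row_mul SH; apply/rowP=> j; rewrite mxE mul_diag_mx !mxE ei0 mul0r.
  move=> rH; apply/negP=> Hu; have r0 : row i S = 0 by rewrite -(mulmxK Hu (row i S)) rH mul0mx.
  have /rowP/(_ i) : row i (S *m invmx S) = 0 by rewrite row_mul r0 mul0mx.
  by rewrite mulmxV // !mxE eqxx => /eqP; rewrite oner_eq0.
split.
  rewrite posE negE -[RHS]card_ord -(cardC [pred i | 0 < -1 * e i]).
  congr (_ + _)%N; apply: eq_card => i; rewrite !inE mul1r mulN1r oppr_gt0.
  by rewrite -leNgt lt_def en0.
rewrite posE negE.
have [P [Pf PP]] := definite_rows 1 Su SH sH.
have [Q [Qf QQ]] := definite_rows (-1) Su SH sH.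
exists P, Q; split=> // x xP x0; first by rewrite -[sprod _ _ _]mul1r PP.
by rewrite -oppr_gt0 -mulN1r QQ.
Qed.

Lemma rank_disjoint_le (p q : nat) (P : 'M[R]_(p, n)) (Q : 'M[R]_(q, n)) :
  (forall x, (x <= P)%MS -> (x <= Q)%MS -> x = 0) -> (\rank P + \rank Q <= n)%N.
Proof.
move=> PQ0; rewrite -mxrank_disjoint_sum ?rank_leq_col //.
apply/eqP/rowV0P=> x; rewrite sub_capmx => /andP[]; exact: PQ0.
Qed.

(** An isotropic subspace meets the definite subspaces P and Q of [inertia] only in 0, and the ranks
    of P and Q add up to n. *)
Lemma isotropic_rank H (p : nat) (U : 'M[R]_(p, n)) : nonsingular_symmetric H ->
  (forall x, (x <= U)%MS -> sprod H x x = 0) -> (\rank U <= space_rank H)%N.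
Proof.
move=> nH U0; have [sum_n [P [Q [Pf Qf PP QQ]]]] := inertia nH.
have lt0 : (\rank U + \rank P <= n)%N.
  apply: rank_disjoint_le => x xU xP; apply/eqP; case: eqP => // /eqP x0.
  by have := PP _ xP x0; rewrite U0 // ltxx.
have gt0 : (\rank U + \rank Q <= n)%N.
  apply: rank_disjoint_le => x xU xP; apply/eqP; case: eqP => // /eqP x0.
  by have := QQ _ xP x0; rewrite U0 // ltxx.
rewrite /space_rank leq_min; move: Pf Qf lt0 gt0; rewrite /row_free => /eqP-> /eqP->; lia.
Qed.

Lemma space_rank_le H : nonsingular_symmetric H -> (2 * space_rank H <= n)%N.
Proof. by case/inertia=> sum_n _; rewrite /space_rank; lia. Qed.

(** This computes the rank in the examples. W meets the negative definite subspace only in 0, which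
    bounds the number of negative eigenvalues by n - rank W = rank U; [isotropic_rank] is the
    reverse inequality. *)
Lemma space_rankP H (p q : nat) (U : 'M[R]_(p, n)) (W : 'M[R]_(q, n)) :
  nonsingular_symmetric H ->
  (forall x, (x <= U)%MS -> sprod H x x = 0) ->
  (forall x, (x <= W)%MS -> 0 <= sprod H x x) ->
  (\rank U + \rank W = n)%N -> space_rank H = \rank U.
Proof.
move=> nH U0 W0 rUW; have [sum_n [P [Q [Pf Qf PP QQ]]]] := inertia nH.
have := isotropic_rank nH U0.
have : (\rank W + \rank Q <= n)%N.
  apply: rank_disjoint_le => x xU xP; apply/eqP; case: eqP => // /eqP x0.
  by have := QQ _ xP x0; rewrite ltNge W0.
rewrite /space_rank; move: Qf; rewrite /row_free => /eqP->; lia.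
Qed.

(** J sends the positive subspace to a negative definite one, which meets the former only in 0, and
    vice versa. So neither inertia index exceeds n / 2, and as their sum is n both equal n / 2. *)
Lemma space_rank_antiisometry H J : nonsingular_symmetric H -> J \in unitmx ->
  (forall x, sprod H (x *m J) (x *m J) = - sprod H x x) ->
  n = (2 * space_rank H)%N.
Proof.
move=> nH Ju HJ; have [sum_n [P [Q [Pf Qf PP QQ]]]] := inertia nH.
have lt0 : (\rank (P *m J) + \rank P <= n)%N.
  apply: rank_disjoint_le => x /submxP[u ->] xP; apply/eqP; case: eqP => // /eqP x0.
  have := PP _ xP x0; rewrite mulmxA HJ oppr_gt0 => /lt_trans H1.
  have uP0 : u *m P != 0 by apply: contraNneq x0; rewrite mulmxA => ->; rewrite mul0mx.
  by have := H1 _ (PP _ (submxMl _ _) uP0); rewrite ltxx.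
have gt0 : (\rank (Q *m J) + \rank Q <= n)%N.
  apply: rank_disjoint_le => x /submxP[u ->] xP; apply/eqP; case: eqP => // /eqP x0.
  have := QQ _ xP x0; rewrite mulmxA HJ oppr_lt0 => H1.
  have uP0 : u *m Q != 0 by apply: contraNneq x0; rewrite mulmxA => ->; rewrite mul0mx.
  by have := lt_trans H1 (QQ _ (submxMl _ _) uP0); rewrite ltxx.
move: lt0 gt0; rewrite !mxrankMfree ?row_free_unit //.
by move: Pf Qf; rewrite /row_free /space_rank => /eqP-> /eqP->; lia.
Qed.

End Inertia.

(** * Adjoints and spectral idempotents *)

Section Adjoint.
Variables (R : realType) (n : nat) (H : 'M[R]_n).
Implicit Types (A B E N : 'M[R]_n) (x y : 'rV[R]_n).

Definition hadj A : 'M[R]_n := H *m A^T *m invmx H.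

Hypothesis nH : nonsingular_symmetric H.
Let sH : H^T = H. Proof. by case: nH. Qed.
Let uH : H \in unitmx. Proof. by case: nH. Qed.

Lemma hadjP A x y : sprod H (x *m hadj A) y = sprod H x (y *m A).
Proof. by have /(is_adjointE A (hadj A) nH) := erefl (hadj A); apply. Qed.

Lemma hadjPr A x y : sprod H (x *m A) y = sprod H x (y *m hadj A).
Proof. by rewrite sprodC // -hadjP sprodC. Qed.

Lemma hadjM A B : hadj (A *m B) = hadj B *m hadj A.
Proof. by rewrite /hadj trmx_mul !mulmxA mulmxKV. Qed.

Lemma hadjK A : hadj (hadj A) = A.
Proof.
rewrite /hadj !trmx_mul trmxK trmx_inv sH !mulmxA mulmxV // mul1mx mulmxK //.
Qed.

Lemma hadjD A B : hadj (A + B) = hadj A + hadj B.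
Proof. by rewrite /hadj linearD mulmxDr mulmxDl. Qed.

Lemma hadjZ a A : hadj (a *: A) = a *: hadj A.
Proof. by rewrite /hadj linearZ -scalemxAr -scalemxAl. Qed.

Lemma hadj_scalar a : hadj a%:M = a%:M.
Proof. by rewrite /hadj tr_scalar_mx scalar_mxC -mulmxA mulmxV // mulmx1. Qed.

Lemma hadjN A : hadj (- A) = - hadj A.
Proof. by rewrite -scaleN1r hadjZ scaleN1r. Qed.

Lemma hadjB A B : hadj (A - B) = hadj A - hadj B.
Proof. by rewrite hadjD hadjN. Qed.

Lemma Hnormal_adj N : Hnormal H N -> N *m hadj N = hadj N *m N.
Proof. by case=> M /(is_adjointE _ _ nH) ->. Qed.

(** Invariance of V under the adjoint amounts to invariance of its orthogonal complement under N, so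
    a proper such V would be a decomposition. *)
Lemma indecomposable_stable N V : indecomposable H N -> V != 0 ->
  (forall x, (x <= V)%MS -> in_perp H V x -> x = 0) ->
  stablemx V N -> stablemx V (hadj N) -> row_full V.
Proof.
move=> iN V0 ndV VN VM; apply: contra_notT iN => Vnf.
exists V; split=> // x xV y yV.
by rewrite hadjPr xV // (submx_trans (submxMr _ yV)).
Qed.

(** The image of a self-adjoint idempotent is nondegenerate: if x = x E is orthogonal to the image,
    then [x, y] = [x, y E] = 0 for all y. Commutation with N passes to the adjoint of N by taking
    adjoints. *)
Lemma indecomposable_idempotent N E : indecomposable H N ->
  E *m E = E -> hadj E = E -> E *m N = N *m E -> E = 0 \/ E = 1%:M.
Proof.
move=> iN EE sE EN; have [->|E0] := eqVneq E 0; first by left.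
have EM : E *m hadj N = hadj N *m E by rewrite -{1}sE -hadjM -EN hadjM sE.
right; have fE : row_full E.
  apply: (indecomposable_stable iN E0) => [x /submxP[u ->] xp||].
  - apply: (sprod_nondeg uH) => y.
    by rewrite -EE mulmxA hadjPr sE xp // submxMl.
  - by rewrite EN submxMl.
  - by rewrite EM submxMl.
have uE : E \in unitmx by rewrite -row_full_unit.
by rewrite -(mulKmx uE E) EE mulVmx.
Qed.

End Adjoint.

Lemma hadj_horner (R : realType) (n : nat) (H N : 'M[R]_n.+1) (p : {poly R}) :
  nonsingular_symmetric H -> hadj H (horner_mx N p) = horner_mx (hadj H N) p.
Proof.
move=> nH; elim/poly_ind: p => [|p c IHp].
  by rewrite !rmorph0 /hadj trmx0 mulmx0 mul0mx.
rewrite !rmorphD !rmorphM /= !horner_mx_X !horner_mx_C hadjD // hadj_scalar //.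
rewrite [hadj H (_ * _)](hadjM nH) IHp; congr (_ + _).
exact: (comm_mx_horner p (erefl _)).
Qed.

Section Fitting.
Variables (F : fieldType) (n : nat).
Implicit Types (T : 'M[F]_n.+1) (g h p q : {poly F}).

(** Fitting decomposition: E projects on the generalized kernel of T. It comes from a Bezout
    relation between a power of X and the factor r of the characteristic polynomial that does not
    vanish at 0. *)
Lemma fitting T : exists g h m, let E := horner_mx T g in
  [/\ E * E = E, T ^+ m * E = 0 & 1 - E = T * horner_mx T h].
Proof.
have [m [r r0 cT]] := multiplicity_XsubC (char_poly T) 0.
rewrite subr0 monic_neq0 ?char_poly_monic //= in r0 cT.
(* The exponent [m.+1] instead of m leaves a factor T in 1 - E even when m = 0. *)
have /Bezout_eq1_coprimepP[[u v] /= uv1] : coprimep ('X ^+ m.+1) r.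
  by rewrite coprimep_expl // coprimep_sym -['X]subr0 -polyC0 coprimep_XsubC.
have Xmr : horner_mx T ('X ^+ m.+1 * r) = 0.
  by rewrite exprSr mulrAC -[X in X * 'X]mulrC -cT rmorphM /= Cayley_Hamilton mul0r.
exists (v * r), (u * 'X ^+ m), m.+1 => /=.
have E1 : 1 - horner_mx T (v * r) = horner_mx T (u * 'X ^+ m.+1).
  by rewrite -(rmorph1 (horner_mx T)) -uv1 rmorphD /= addrK.
split.
- apply/eqP; rewrite -subr_eq0 -opprB oppr_eq0 -{1}[horner_mx T _]mulr1 -mulrBr E1.
  by rewrite -rmorphM /= mulrCA -mulrA mulrA rmorphM /= [r * _]mulrC Xmr mulr0.
- have -> : T ^+ m.+1 = horner_mx T ('X ^+ m.+1) by rewrite rmorphXn /= horner_mx_X.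
  by rewrite -rmorphM /= mulrCA rmorphM /= Xmr mulr0.
- by rewrite E1 exprS mulrCA rmorphM /= horner_mx_X.
Qed.

End Fitting.

(** * Complex eigenvalues and real annihilating polynomials *)

Section ComplexEigenvalues.
Variables (R : realType) (n : nat).
Implicit Types (N : 'M[R]_n.+1) (l z : R[i]) (p q : {poly R}).
Local Notation toC := (map_poly (real_complex R)).

(** The real polynomial (X - l)(X - conj l). For real l it is the square (X - l)^2, so that real and
    nonreal eigenvalues can be treated together. *)
Definition conj_poly l : {poly R} :=
  'X^2 - (2 * complex.Re l) *: 'X + (complex.Re l ^+ 2 + complex.Im l ^+ 2)%:P.

Lemma toC_conj_poly l : toC (conj_poly l) = ('X - l%:P) * ('X - (conjc l)%:P).
Proof.
case: l => a b; rewrite /conj_poly /= rmorphD rmorphB /= map_polyXn map_polyZ /= map_polyX map_polyC /=.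
have -> : ('X - (a +i* b)%C%:P) * ('X - (a -i* b)%C%:P) =
  'X^2 - ((a +i* b)%C + (a -i* b)%C) *: 'X + ((a +i* b)%C * (a -i* b)%C)%:P :> {poly R[i]}.
  rewrite -mul_polyC !rmorphD rmorphM /=; ring.
congr (_ - _ *: _ + _%:P); apply/eqP; rewrite eq_complex /=; apply/andP; split; apply/eqP; simpc; ring.
Qed.

Lemma root_toC_conj_poly l z :
  root (toC (conj_poly l)) z = (z == l) || (z == conjc l).
Proof. by rewrite toC_conj_poly rootM !root_XsubC. Qed.

Lemma root_toC_conj p z : root (toC p) (conjc z) = root (toC p) z.
Proof.
rewrite -complex_root_conj -map_poly_comp.
by congr root; apply: eq_map_poly => x /=; rewrite oppr0.
Qed.

Lemma eigenvalue_annihilator N p z : horner_mx N p = 0 ->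
  complex_eigenvalues N z -> root (toC p) z.
Proof.
move=> Np0; rewrite /complex_eigenvalues map_char_poly -eigenvalue_root_char.
rewrite eigenvalue_root_min -!dvdp_XsubCl => rz; apply: (dvdp_trans rz).
by apply: mxminpoly_min; rewrite -map_horner_mx Np0 map_mx0.
Qed.

(** Over the complex numbers the characteristic polynomial is a product of factors X - z, each
    dividing p, hence it divides a power of p. Cayley-Hamilton applies there, and the resulting
    identity descends to the reals. *)
Lemma annihilator_eigenvalues N p :
  (forall z, complex_eigenvalues N z -> root (toC p) z) ->
  exists m, horner_mx N (p ^+ m) = 0.
Proof.
move=> Np; have [rs] := closed_field_poly_normal (toC (char_poly N)).
have -> : lead_coef (toC (char_poly N)) = 1.
  by rewrite lead_coef_map (monicP (char_poly_monic N)) rmorph1.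
rewrite scale1r => rsE; exists (size rs).
have rsP z : z \in rs -> root (toC p) z.
  by move=> zrs; apply: Np; rewrite /complex_eigenvalues rsE root_prod_XsubC.
have /dvdpP[q qE] : toC (char_poly N) %| toC p ^+ size rs.
  rewrite rsE; elim: {rsE} rs rsP => [|z rs IHrs] rsP; first by rewrite big_nil dvd1p.
  rewrite big_cons exprS dvdp_mul //.
    by rewrite dvdp_XsubCl rsP ?mem_head.
  by apply: IHrs => z' z'rs; rewrite rsP ?inE ?z'rs ?orbT.
apply: (@map_mx_inj _ _ (real_complex R)).
rewrite map_mx0 map_horner_mx rmorphXn /= qE rmorphM /= map_char_poly.
by rewrite Cayley_Hamilton mulr0.
Qed.

End ComplexEigenvalues.

Section Eigenvalues.
Variables (R : realType) (n : nat).
Implicit Types (N : 'M[R]_n.+1) (l z : R[i]).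

Lemma eigenvector_horner (F : fieldType) (A : 'M[F]_n.+1) a (v : 'rV_n.+1) p :
  v *m A = a *: v -> v *m horner_mx A p = p.[a] *: v.
Proof.
move=> vA; elim/poly_ind: p => [|p c IHp].
  by rewrite rmorph0 mulmx0 horner0 scale0r.
rewrite rmorphD rmorphM /= horner_mx_X horner_mx_C mulmxDr hornerMXaddC.
by rewrite mulmxA IHp -scalemxAl vA mul_mx_scalar scalerA -scalerDl.
Qed.

(** A complex eigenvector for l is killed by this polynomial in N. *)
Lemma conj_poly_not_invertible N l B :
  complex_eigenvalues N l -> horner_mx N (conj_poly l) * B <> 1.
Proof.
rewrite /complex_eigenvalues map_char_poly -eigenvalue_root_char.
case/eigenvalueP=> v vN v0 /(congr1 (map_mx (real_complex R))) TB1.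
have := eigenvector_horner (map_poly (real_complex R) (conj_poly l)) vN.
have /rootP -> : root (map_poly (real_complex R) (conj_poly l)) l.
  by rewrite root_toC_conj_poly eqxx.
rewrite scale0r -map_horner_mx => /(congr1 (mulmx^~ (map_mx (real_complex R) B))).
rewrite -mulmxA -map_mxM [X in map_mx _ X](_ : _ = 1%:M); last first.
  exact: (map_mx_inj (etrans TB1 _)).
by rewrite map_mx1 mulmx1 mul0mx; apply/eqP.
Qed.

Lemma complex_eigenvalues_conj N z :
  complex_eigenvalues N (conjc z) = complex_eigenvalues N z.
Proof. exact: root_toC_conj. Qed.

Lemma annihilated_pair N l m : complex_eigenvalues N l ->
  horner_mx N (conj_poly l ^+ m) = 0 ->
  complex_eigenvalues N =i [:: l; conjc l].
Proof.
move=> Nl Nm z; rewrite !inE; apply/idP/idP => [Nz|].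
  have := eigenvalue_annihilator Nm Nz; rewrite rmorphXn /= -root_toC_conj_poly.
  case: m {Nm} => [|m]; first by rewrite expr0 (negPf (root1 _)).
  by rewrite /root horner_exp expf_eq0.
by case/orP=> /eqP ->; rewrite -[_ \in _]/(complex_eigenvalues N _) ?complex_eigenvalues_conj.
Qed.

End Eigenvalues.

(** * At most two primary components *)

Section Dichotomy.
Variables (R : realType) (n : nat) (H N : 'M[R]_n.+1).
Hypotheses (nH : nonsingular_symmetric H) (iN : indecomposable H N)
           (norN : Hnormal H N).
Implicit Types (E F T : 'M[R]_n.+1).
Local Notation "A ^[*]" := (hadj H A) (at level 2, format "A ^[*]").
Local Notation ev p := (horner_mx N p).

Let commN : N * N^[*] = N^[*] * N.
Proof. exact (Hnormal_adj nH norN). Qed.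

Let hadjM' E F : (E * F)^[*] = F^[*] * E^[*].
Proof. exact: (hadjM nH). Qed.


(** The product E E^[*] is a self-adjoint idempotent commuting with N, hence 0 or 1; if it is 1,
    then E = E E E^[*] = E E^[*] = 1. *)
Lemma idempotent_adj E : E * E = E -> E * E^[*] = E^[*] * E ->
  E * N = N * E -> E * N^[*] = N^[*] * E -> E = 1 \/ E * E^[*] = 0.
Proof.
move=> EE EE' EN EM.
have E'E' : E^[*] * E^[*] = E^[*] by rewrite -[LHS]hadjM' -[in RHS]EE.
have E'N : E^[*] * N = N * E^[*].
  by have := congr1 (hadj H) EM; rewrite (hadjM' E) (hadjM' N^[*]) !hadjK.
have [|||P0|P1] := indecomposable_idempotent nH iN (E := E * E^[*]).
- by rewrite -[LHS]mulrA [E^[*] * _]mulrA -EE' -mulrA E'E' mulrA EE.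
- by rewrite (hadjM' E) hadjK.
- by rewrite -[LHS]mulrA E'N [LHS]mulrA EN -mulrA.
- by right.
- have {}P1 : E * E^[*] = 1 by [].
  by left; rewrite -[E]mulr1 -P1 mulrA EE.
Qed.

(** Apply [idempotent_adj] to the Fitting idempotent E of T and to 1 - E. If E = 1 then T is
    nilpotent, and 1 - E = 1 would make T invertible. Otherwise E E^[*] = 0 and (1 - E)(1 - E^[*]) =
    0, whose sum gives E + E^[*] = 1. *)
Lemma spectral_component (q : {poly R}) (T := ev q) :
  (forall B, T * B <> 1) ->
  (exists m, ev (q ^+ m) = 0) \/
  exists E h m, [/\ E * E = E, E + E^[*] = 1, T ^+ m * E = 0,
    1 - E = T * horner_mx T h & forall A, T * A = A * T -> E * A = A * E].
Proof.
move=> nuT; have [g [h [m [EE TE E1]]]] := fitting T.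
move: EE TE E1; set E := horner_mx T g => EE TE E1.
have commT A : T * A = A * T -> E * A = A * E.
  by move=> TA; apply: comm_horner_mx.
have TT : T * T^[*] = T^[*] * T.
  rewrite /T hadj_horner //; apply: comm_horner_mx; apply: comm_mx_horner.
  exact: commN.
have EN : E * N = N * E by apply/commT/comm_horner_mx.
have EM : E * N^[*] = N^[*] * E by apply/commT/comm_horner_mx.
have EE' : E * E^[*] = E^[*] * E.
  by rewrite {2 3}/E hadj_horner //; apply/commT/comm_mx_horner.
have [E_1|E0] := idempotent_adj EE EE' EN EM.
  by left; exists m; rewrite rmorphXn -[LHS]mulr1 -E_1.
right; exists E, h, m; split=> //.
have F' : (1 - E)^[*] = 1 - E^[*] by rewrite hadjB (hadj_scalar nH).
have [||||F1|] := idempotent_adj (E := 1 - E).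
- by rewrite mulrBl mul1r mulrBr mulr1 EE subrr subr0.
- by rewrite F' !mulrBl !mulrBr !(mul1r, mulr1) EE' !opprB addrACA [RHS]addrACA; congr (_ + _); rewrite addrC.
- by rewrite mulrBl mulrBr mul1r mulr1 EN.
- by rewrite mulrBl mulrBr mul1r mulr1 EM.
- by case: (nuT (horner_mx T h)); rewrite -E1.
- rewrite F' mulrBl mul1r mulrBr mulr1 E0 subr0 => /eqP; rewrite subr_eq0 subr_eq => /eqP ->.
  by rewrite addrC.
Qed.

(** Both images are isotropic, hence of rank at most k, and together they span the space; conversely
    2k never exceeds the dimension. *)
Lemma halves E : E * E = E -> E + E^[*] = 1 ->
  n.+1 = (2 * space_rank H)%N /\ \rank E = space_rank H.
Proof.
move=> EE E1; have E'E : E^[*] = 1 - E by rewrite -E1 addrAC subrr add0r.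
have E0 : E * E^[*] = 0 by rewrite E'E mulrBr mulr1 EE subrr.
have E0' : E^[*] * E = 0 by rewrite E'E mulrBl mul1r EE subrr.
have rE : (\rank E <= space_rank H)%N.
  apply: isotropic_rank => // x /submxP[u ->].
  by rewrite (hadjPr nH) -(mulmxA u E) (E0 : E *m _ = 0) mulmx0 sprod0r.
have rE' : (\rank E^[*] <= space_rank H)%N.
  apply: isotropic_rank => // x /submxP[u ->].
  by rewrite (hadjP nH) -(mulmxA u) (E0' : _ *m E = 0) mulmx0 sprod0r.
have : (n.+1 <= \rank E + \rank E^[*])%N.
  by rewrite -{1}(mxrank1 R n.+1) -[1%:M]E1 mxrank_add.
have := space_rank_le nH; lia.
Qed.


(** If the component of l is not everything, another eigenvalue l' exists, and [spectral_component]
    gives idempotents E and E' for l and l'. They satisfy E E' = 0 and E' = 1 - E, so no third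
    component is left. *)
Lemma spectral_type l : complex_eigenvalues N l ->
  (exists m, ev (conj_poly l ^+ m) = 0) \/
  exists E m, [/\ E * E = E, E + E^[*] = 1,  ev (conj_poly l ^+ m) * E = 0,
     E * N = N * E & exists l', [/\ complex_eigenvalues N l', l' != l, l' != conjc l &
      complex_eigenvalues N =i [:: l; conjc l; l'; conjc l']]].
Proof.
move=> Nl.
have [|[E [h [m [EE E1 TE EF commE]]]]] :=
  @spectral_component (conj_poly l) (fun B => @conj_poly_not_invertible _ _ N l B Nl).
  by left.
right; exists E, m; have TmE : ev (conj_poly l ^+ m) * E = 0 by rewrite rmorphXn.
have commEp p : E * ev p = ev p * E.
  by apply: commE; rewrite -!rmorphM mulrC.
split=> //; first by have := commEp 'X; rewrite /= horner_mx_X.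
(* With no eigenvalue besides l and its conjugate, [conj_poly l] would be nilpotent at N. Then the
   idempotent 1 - E, a multiple of it, would vanish, and E = 1 contradicts E + E^[*] = 1. *)
have [l' Nl' /norP[l'l l'cl]] : exists2 l', complex_eigenvalues N l' &
    ~~ ((l' == l) || (l' == conjc l)).
  apply/not_exists2P => all_l; have [z Nz|b Tb] := @annihilator_eigenvalues _ _ N (conj_poly l).
    by rewrite root_toC_conj_poly; have [|/negP] := all_l z; last by rewrite negbK.
  have : E = 1.
    have F2 i : (1 - E) ^+ i.+1 = 1 - E.
      by elim: i => // i IHi; rewrite exprS IHi mulrBl mul1r mulrBr mulr1 EE subrr subr0.
    apply/eqP; rewrite eq_sym -subr_eq0 -(F2 b) EF exprMn_comm; last first.
      exact: comm_mx_horner.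
    by rewrite exprS -rmorphXn /= Tb mulr0 mul0r.
  move=> E_1; move: E1; rewrite E_1 (hadj_scalar nH) => /eqP; rewrite -subr_eq0 addrK.
  by rewrite oner_eq0.
have lq' : ~~ ((l == l') || (l == conjc l')).
  apply/norP; split; first by rewrite eq_sym.
  by apply: contra l'cl => /eqP ->; rewrite conjcK.
exists l'; split=> //.
have [[b Tb]|[E' [h' [m' [EE' E1' TE' EF' commE']]]]] :=
  @spectral_component (conj_poly l') (fun B => @conj_poly_not_invertible _ _ N l' B Nl').
  by have := annihilated_pair Nl' Tb l; rewrite !inE (negPf lq') [X in X = _]Nl.
have Tm'E' : ev (conj_poly l' ^+ m') * E' = 0 by rewrite rmorphXn.
have commEp' p : E' * ev p = ev p * E'.
  by apply: commE'; rewrite -!rmorphM mulrC.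
have EcE' : E * E' = E' * E by apply: commE; rewrite commEp'.
have cop : coprimep (conj_poly l ^+ m) (conj_poly l' ^+ m').
  rewrite coprimep_expl // coprimep_expr // -(coprimep_map (real_complex R)).
  apply: Pdiv.ClosedField.root_coprimep => x; rewrite root_toC_conj_poly -rootE.
  rewrite root_toC_conj_poly => /orP[] /eqP ->; first exact: lq'.
  rewrite negb_or eq_sym l'cl /=; apply: contra l'l => /eqP/(congr1 (@conjc R)).
  by rewrite !conjcK => ->.
have EE0 : E * E' = 0.
  have /Bezout_eq1_coprimepP[[u v] /= uv1] := cop.
  rewrite -[LHS]mul1r -(rmorph1 (horner_mx N)) -uv1 rmorphD !rmorphM mulrDl.
  rewrite -!mulrA [_ * (E * E')]mulrA TmE mul0r mulr0 add0r EcE'.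
  by rewrite [_ * (E' * E)]mulrA Tm'E' mul0r mulr0.
(* The adjoint of E E' = 0 reads (1 - E')(1 - E) = 0, which expands to 1 - E - E' = 0. *)
have E'_ : E' = 1 - E.
  have : (E * E')^[*] = 0 by rewrite EE0 /hadj trmx0 mulmx0 mul0mx.
  have cE F : F + F^[*] = 1 -> F^[*] = 1 - F by move=> <-; rewrite addrAC subrr add0r.
  rewrite hadjM' (cE _ E1) (cE _ E1') mulrBl mul1r mulrBr mulr1 -EcE' EE0 subr0.
  by move=> /eqP; rewrite subr_eq0 => /eqP ->.
move=> z; rewrite -[_ \in complex_eigenvalues N]/(complex_eigenvalues N z) !inE.
apply/idP/idP => [Nz|].
  have Np : ev (conj_poly l ^+ m * conj_poly l' ^+ m') = 0.
    rewrite -[LHS]mulr1; have -> : 1 = E + E' by rewrite E'_ addrC subrK.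
    rewrite mulrDr {1}mulrC !rmorphM /= -!mulrA Tm'E' TmE !mulr0.
    by rewrite addr0.
  have := eigenvalue_annihilator Np Nz.
  rewrite rmorphM !rmorphXn rootM.
  have re p a : root (p ^+ a) z -> root p z.
    case: a => [|a]; first by rewrite expr0 (negPf (root1 _)).
    by rewrite /root horner_exp expf_eq0.
  by case/orP=> /re; rewrite root_toC_conj_poly => /orP[] ->; rewrite ?orbT.
by case/or4P=> /eqP ->; rewrite ?complex_eigenvalues_conj.
Qed.

End Dichotomy.

(** * Complex structures *)

Section ComplexStructure.
Variable (R : realType).

(* Hensel lifting of a root of g^2 + 1 modulo powers of conj_poly l. *)
Lemma complex_structure_poly (l : R[i]) m : nonreal l ->
  exists g : {poly R}, conj_poly l ^+ m.+1 %| g ^+ 2 + 1 /\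
    conj_poly l %| (complex.Re l)%:P + (complex.Im l) *: g - 'X.
Proof.
case: l => a b; rewrite /nonreal /= => b0; set q := conj_poly _.
have qE : q = ('X - a%:P) ^+ 2 + (b ^+ 2)%:P.
  rewrite /q /conj_poly /= -mul_polyC; ring.
elim: m => [|m [g [gg gX]]].
  (* Modulo (X - a)^2 + b^2 a square root of -1 is (X - a) / b. *)
  exists (b^-1 *: ('X - a%:P)); split; last first.
    by rewrite scalerA divff // scale1r addrCA subrr addr0 subrr dvdp0.
  rewrite expr1 exprZn.
  have -> : b^-1 ^+ 2 *: ('X - a%:P) ^+ 2 + 1 = b^-1 ^+ 2 *: q.
    by rewrite qE scalerDr -[_ *: (b ^+ 2)%:P]mul_polyC -polyCM -exprMn mulVf // expr1n.
  by rewrite dvdpZr ?expf_neq0 ?invr_neq0.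
(* Newton step: the correction is -(g^2 + 1) / (2 g), and -1 / g is g modulo q because g^2 = -1
   there. *)
have /dvdpP[w gE] := gg; pose c := 2^-1 *: (g * w).
have c2 : 2 * c = g * w.
  by rewrite /c -scalerAr mulr_natl -scaler_nat scalerA mulVf ?pnatr_eq0 // scale1r.
exists (g + c * q ^+ m.+1); split; last first.
  have -> : a%:P + b *: (g + c * q ^+ m.+1) - 'X =
            (a%:P + b *: g - 'X) + b *: (c * q ^+ m) * q.
    by rewrite exprSr -!mul_polyC; ring.
  by rewrite dvdp_add // dvdp_mull.
have -> : (g + c * q ^+ m.+1) ^+ 2 + 1 =
     (g ^+ 2 + 1) + g * (2 * c) * q ^+ m.+1 + (q ^+ m * c ^+ 2) * q ^+ m.+2.
  by rewrite [q ^+ m.+2]exprS [q ^+ m.+1]exprS; ring.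
have -> : g ^+ 2 + 1 + g * (2 * c) * q ^+ m.+1 = w * (g ^+ 2 + 1) * q ^+ m.+1.
  by rewrite c2 {1}gE; ring.
apply: dvdp_add; last exact: dvdp_mull.
rewrite [q ^+ m.+2]exprS dvdp_mul //.
by rewrite dvdp_mull // (dvdp_trans _ gg) // exprS dvdp_mulr.
Qed.

(** This is the Jordan-Chevalley decomposition: Re l + Im l J is the semisimple part of N, and J is
    a polynomial in N. *)
Lemma complex_structure n (N : 'M[R]_n.+1) (l : R[i]) m : nonreal l ->
  horner_mx N (conj_poly l ^+ m) = 0 ->
  exists g, let J := horner_mx N g in J * J = -1 /\
    exists m', (N - (complex.Re l)%:M - complex.Im l *: J) ^+ m' = 0.
Proof.
move=> nrl Nm; have [g [/dvdpP[w gE] /dvdpP[v vE]]] := complex_structure_poly m nrl.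
exists g; split.
  apply/eqP; rewrite -addr_eq0 -expr2 -rmorphXn -(rmorph1 (horner_mx N)) -rmorphD /=.
  by rewrite gE exprS mulrA rmorphM /= Nm mulr0.
exists m; have -> : N - (complex.Re l)%:M - complex.Im l *: horner_mx N g =
    - horner_mx N (v * conj_poly l).
  rewrite -vE rmorphB rmorphD /= horner_mx_C horner_mx_X horner_mxZ.
  by rewrite opprB opprD addrA.
by rewrite exprNn -rmorphXn exprMn mulrC rmorphM /= Nm mul0r mulr0.
Qed.

(** The square of det J equals (-1)^n, so it is negative when n is odd. *)
Lemma complex_structure_even n (J : 'M[R]_n) : J *m J = - 1%:M -> ~~ odd n.
Proof.
move=> JJ; apply/negP=> on; have := congr1 determinant JJ.
rewrite det_mulmx -scaleN1r detZ det1 mulr1 -signr_odd on expr1 => dJ.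
by have := sqr_ge0 (\det J); rewrite expr2 dJ oppr_ge0 ler10.
Qed.

(** The restriction N' of N to the image of E, written in a row basis B, is annihilated by a power
    of [conj_poly l], so the image carries a complex structure. *)
Lemma nonreal_component_even n (N E : 'M[R]_n.+1) (l : R[i]) m : nonreal l ->
  E *m E = E -> E *m N = N *m E -> horner_mx N (conj_poly l ^+ m) *m E = 0 ->
  ~~ odd (\rank E).
Proof.
move=> nrl EE EN NE; set q := _ ^+ m in NE.
case Dr : (\rank E) => [|r] //.
have [B [Bf BE]] : exists B : 'M_(r.+1, n.+1), row_free B /\ (B :=: E)%MS.
  by rewrite -Dr; exists (row_base E); rewrite row_base_free; split; [|exact: eq_row_base].
have stN : stablemx B N by rewrite (eqmxMr _ BE) BE EN submxMl.
have [N' BN] : exists N', B *m N = N' *m B by case/submxP: stN => N' ->; exists N'.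
have BNp p : B *m horner_mx N p = horner_mx N' p *m B.
  elim/poly_ind: p => [|p c IHp]; first by rewrite !rmorph0 mulmx0 mul0mx.
  rewrite !rmorphD !rmorphM /= !horner_mx_X !horner_mx_C mulmxDr mulmxDl mulmxA IHp.
  by rewrite -!mulmxA BN scalar_mxC.
have /complex_structure[//|g [JJ _]] : horner_mx N' (conj_poly l ^+ m) = 0.
  apply/eqP; rewrite -(mulmx_free_eq0 _ Bf) -BNp.
  have /submxP[D ->] : (B <= E)%MS by rewrite BE.
  rewrite -mulmxA; suff -> : E *m horner_mx N q = 0 by rewrite mulmx0.
  by rewrite -[RHS]NE; apply: comm_mx_horner.
exact: complex_structure_even JJ.
Qed.

End ComplexStructure.

(** * The bound n <= 4k *)

Lemma last_power_notin (F : fieldType) (n : nat) (A L : 'M[F]_n.+1) m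
    (x : 'rV_n.+1) :
  (x *m A ^+ m <= L)%MS -> ~~ (x <= L)%MS ->
  exists i, ~~ (x *m A ^+ i <= L)%MS /\ (x *m A ^+ i *m A <= L)%MS.
Proof.
elim: m => [|m IHm] xm xL; first by rewrite mulmx1 (negPf xL) in xm.
have [xmL|xmL] := boolP (x *m A ^+ m <= L)%MS; first exact: IHm.
by exists m; split=> //; rewrite -mulmxA -[A ^+ m *m A]exprSr.
Qed.

Section Perp.
Variables (R : realType) (n : nat) (H : 'M[R]_n).
Hypothesis nH : nonsingular_symmetric H.
Implicit Types (V : 'M[R]_n) (x y : 'rV[R]_n).

Definition perp V : 'M[R]_n := kermx (H *m V^T).

Lemma perpP V x : reflect (forall y, (y <= V)%MS -> sprod H x y = 0) (x <= perp V)%MS.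
Proof.
apply: (iffP sub_kermxP) => [xV y /submxP[u ->]|xV].
  by rewrite sprodE trmx_mul mulmxA -(mulmxA x) xV mul0mx mxE.
apply/rowP=> j; rewrite [RHS]mxE -[RHS](xV _ (row_sub j V)).
rewrite sprodE tr_row mulmxA !mxE.
by apply: eq_bigr => i _; rewrite !mxE.
Qed.

Lemma rank_perp V : \rank (perp V) = (n - \rank V)%N.
Proof.
have [sH uH] := nH.
by rewrite mxrank_ker -mxrank_tr trmx_mul trmxK sH mxrankMfree // row_free_unit.
Qed.

End Perp.

Section IsotropicBound.
Variables (R : realType) (n : nat) (H : 'M[R]_n.+1).
Hypothesis nH : nonsingular_symmetric H.
Implicit Types (A B J L V W : 'M[R]_n.+1) (x y z : 'rV[R]_n.+1).

Local Notation perpH := (perp H).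

Definition isotropic V := forall x y, (x <= V)%MS -> (y <= V)%MS -> sprod H x y = 0.

(** A is the nilpotent part of N. The setting covers a real eigenvalue, with J = 1 and e = 1, and a
    nonreal pair whose J is an isometry, with e = -1. Indecomposability enters only through
    [kerAB]. *)
Variables (A J : 'M[R]_n.+1) (m : nat) (e : R).
Local Notation B := (hadj H A).
Hypotheses (commAB : A *m B = B *m A) (Am : A ^+ m = 0)
  (commJA : J *m A = A *m J) (commJB : J *m B = B *m J)
  (isoJ : forall x y, sprod H (x *m J) (y *m J) = sprod H x y)
  (JJ : J *m J = e%:M) (e2 : e * e = 1)
  (Jx : forall x, sprod H x x = 0 -> sprod H x (x *m J) = 0)
  (kerAB : forall x, x *m A = 0 -> x *m B = 0 -> sprod H x x = 0).

Definition isotropic_invariant L :=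
  [/\ isotropic L, stablemx L A, stablemx L B & stablemx L J].

Lemma maximal_isotropic_invariant : exists L, isotropic_invariant L /\
  forall L', isotropic_invariant L' -> (\rank L' <= \rank L)%N.
Proof.
pose P d := `[< exists L, isotropic_invariant L /\ \rank L = d >].
have exP : exists d, P d.
  exists 0%N; apply/asboolP; exists 0; rewrite mxrank0; split=> //.
  split; rewrite ?mul0mx ?sub0mx //.
  by move=> x y; rewrite submx0 => /eqP ->; rewrite sprod0l.
have ubP d : P d -> (d <= n.+1)%N.
  by move=> /asboolP[L [_ <-]]; exact: rank_leq_row.
case: (ex_maxnP exP ubP) => d /asboolP[L [LI Ld]] dmax; exists L; split=> // L' L'I.
by rewrite Ld dmax //; apply/asboolP; exists L'.
Qed.

(** By maximality this will force x into L. The vector x J is orthogonal to L as well, because any y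
    in L is e (y J) J and J is an isometry preserving L. *)
Lemma isotropic_extension L x : isotropic_invariant L ->
    (forall y, (y <= L)%MS -> sprod H x y = 0) ->
    (x *m A <= L)%MS -> (x *m B <= L)%MS -> sprod H x x = 0 ->
  isotropic_invariant (L + (x + x *m J))%MS.
Proof.
move=> [L0 LA LB LJ] xL xA xB xx; have [sH uH] := nH.
have xJL y : (y <= L)%MS -> sprod H (x *m J) y = 0.
  move=> yL; have -> : y = e *: (y *m J *m J).
    by rewrite -mulmxA JJ mul_mx_scalar scalerA e2 scale1r.
  by rewrite sprodZr isoJ xL ?mulr0 // (submx_trans (submxMr _ yL)).
have inE y : (y <= L + (x + x *m J))%MS -> exists l a b,
    (l <= L)%MS /\ y = l + (a *: x + b *: (x *m J)).
  case/sub_addsmxP=> -[u v] /= ->.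
  have /sub_addsmxP[[a b] /= ->] : (v *m (x + x *m J)%MS <= x + x *m J)%MS by exact: submxMl.
  exists (u *m L), (a 0 0), (b 0 0); rewrite submxMl; split=> //.
  by rewrite {1}(mx11_scalar a) {1}(mx11_scalar b) !mul_scalar_mx.
split.
- move=> y z /inE[l [a [b [lL ->]]]] /inE[l' [a' [b' [l'L ->]]]].
  rewrite !(sprodDl, sprodDr, sprodZl, sprodZr) (L0 l) // isoJ xx.
  rewrite (sprodC l x sH) (sprodC l (x *m J) sH) (sprodC (x *m J) x sH) Jx //.
  by rewrite !xJL ?xL // !(mulr0, addr0).
- rewrite !(addsmxMr, addsmx_sub) (submx_trans LA) ?addsmxSl //=.
  rewrite (submx_trans xA) ?addsmxSl //= -mulmxA commJA mulmxA.
  by rewrite (submx_trans (submxMr J xA)) // (submx_trans LJ) ?addsmxSl.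
- rewrite !(addsmxMr, addsmx_sub) (submx_trans LB) ?addsmxSl //=.
  rewrite (submx_trans xB) ?addsmxSl //= -mulmxA commJB mulmxA.
  by rewrite (submx_trans (submxMr J xB)) // (submx_trans LJ) ?addsmxSl.
- rewrite !(addsmxMr, addsmx_sub) (submx_trans LJ) ?addsmxSl //=.
  rewrite -mulmxA JJ mul_mx_scalar scalemx_sub ?andbT.
    by rewrite (submx_trans (addsmxSr x _)) ?addsmxSr.
  by rewrite (submx_trans (addsmxSl x (x *m J))) ?addsmxSr.
Qed.

(** Take L maximal and let W be the part of its orthogonal complement that A and B map into L. Two
    estimates, n - dim L <= dim W and dim W <= 3 dim L, give the bound, n being here the dimension
    of the whole space. *)
Lemma isotropic_bound : exists L, [/\ isotropic L, stablemx L J &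
  (n.+1 <= 4 * \rank L)%N].
Proof.
have [sH uH] := nH; have [L [LI Lmax]] := maximal_isotropic_invariant.
have [L0 LA LB LJ] := LI; exists L; split=> //.
have Bm : B ^+ m = 0.
  have -> : B ^+ m = hadj H (A ^+ m).
    elim: (m) => [|i IHi]; first by rewrite !expr0 (hadj_scalar nH).
    by rewrite exprSr IHi exprS [RHS](hadjM nH).
  by rewrite Am /hadj trmx0 mulmx0 mul0mx.
pose W := (perpH L :&: (kermx (A *m cokermx L) :&: kermx (B *m cokermx L)))%MS.
have inW x : reflect [/\ forall y, (y <= L)%MS -> sprod H x y = 0, (x *m A <= L)%MS
    & (x *m B <= L)%MS] (x <= W)%MS.
  rewrite !sub_capmx; apply: (iffP and3P) => -[].
    move=> /perpP xL /sub_kermxP xA /sub_kermxP xB; split=> //.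
      by rewrite submxE -mulmxA xA.
    by rewrite submxE -mulmxA xB.
  rewrite (submxE (x *m A)) (submxE (x *m B)) => xL /eqP xA /eqP xB; split; first exact/perpP.
    by apply/sub_kermxP; rewrite mulmxA.
  by apply/sub_kermxP; rewrite mulmxA.
have LW : (L <= W)%MS.
  apply/rV_subP=> x xL; apply/inW; split=> [y yL||]; first exact: L0.
    exact: submx_trans (submxMr _ xL) LA.
  exact: submx_trans (submxMr _ xL) LB.
have anisoW x : (x <= W)%MS -> sprod H x x = 0 -> (x <= L)%MS.
  case/inW=> xL xA xB xx; have L'I := isotropic_extension LI xL xA xB xx.
  have LL' : (L <= L + (x + x *m J))%MS by exact: addsmxSl.
  have /(submx_trans _) -> // : (L + (x + x *m J) <= L)%MS.
    by rewrite -(mxrank_leqif_sup LL') eqn_leq mxrankS //= Lmax.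
  by rewrite (submx_trans (addsmxSl x (x *m J))) ?addsmxSr.
(* The complement of W is invariant under A and B. Starting from a vector of it outside L, the last
   powers of A and then of B that stay outside L give a vector z with z A and z B in L. Then z lies
   both in W and in its complement, so it is isotropic and [anisoW] puts it in L, a
   contradiction. *)
have VL : (perpH W <= L)%MS.
  have stA (C : 'M[R]_n.+1) : (W *m C <= W)%MS ->
      forall x, (x <= perpH W)%MS -> (x *m hadj H C <= perpH W)%MS.
    move=> WC x /perpP xW; apply/perpP=> y yW.
    by rewrite (hadjP nH) xW // (submx_trans (submxMr _ yW)).
  have WA : (W *m A <= W)%MS.
    apply/(submx_trans _ LW)/row_subP=> i; rewrite row_mul.
    by have /inW[] := row_sub i W.
  have WB : (W *m B <= W)%MS.
    apply/(submx_trans _ LW)/row_subP=> i; rewrite row_mul.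
    by have /inW[] := row_sub i W.
  have VB := stA _ WA; have := stA _ WB; rewrite (hadjK nH) => VA.
  have Vpow (C : 'M[R]_n.+1) : (forall x, (x <= perpH W)%MS -> (x *m C <= perpH W)%MS) ->
      forall i x, (x <= perpH W)%MS -> (x *m C ^+ i <= perpH W)%MS.
    move=> VC; elim=> [|i IHi] x xV; first by rewrite mulmx1.
    by rewrite exprSr [_ *m _]mulmxA VC // IHi.
  apply/rV_subP=> x xV; apply/negPn/negP=> xL.
  have [|i [yL yA]] := @last_power_notin _ _ A L m x _ xL.
    by rewrite Am mulmx0 sub0mx.
  have yV := Vpow A VA i x xV; move: (x *m A ^+ i) yL yA yV => y yL yA yV.
  have [|j [zL zB]] := @last_power_notin _ _ B L m y _ yL.
    by rewrite Bm mulmx0 sub0mx.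
  have zV := Vpow B VB j y yV.
  have zA : (y *m B ^+ j *m A <= L)%MS.
    have -> : y *m B ^+ j *m A = y *m A *m B ^+ j.
      rewrite -!mulmxA; congr (_ *m _).
      by have /esym := commrX j (commAB : GRing.comm A B).
    elim: (j) => [|k IHk]; first by rewrite mulmx1.
    by rewrite exprSr [_ *m (_ * _)]mulmxA (submx_trans (submxMr _ IHk)).
  have zW : (y *m B ^+ j <= W)%MS.
    apply/inW; split=> // t tL.
    by have /perpP := zV; apply; apply: submx_trans tL LW.
  by case/negP: zL; apply: anisoW => //; have /perpP := zV; apply.
have rW : (n.+1 <= \rank W + \rank L)%N.
  by have := mxrankS VL; rewrite (rank_perp nH); lia.
(* Rank-nullity for x |-> (x A, x B) on W: the kernel consists of isotropic vectors of W, so it lies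
   in L, and the image lies in two copies of L. *)
have rker : (\rank (W :&: kermx (row_mx A B)) <= \rank L)%N.
  apply/mxrankS/rV_subP=> x; rewrite sub_capmx => /andP[xW /sub_kermxP].
  rewrite mul_mx_row -[0]row_mx0 => /eq_row_mx[xA xB].
  by apply: anisoW => //; apply: kerAB.
have rim : (\rank (W *m row_mx A B) <= 2 * \rank L)%N.
  rewrite mul_mx_row -mxrank_tr tr_row_mx -addsmxE.
  apply: (leq_trans (mxrank_adds_leqif _ _).1); rewrite !mxrank_tr mul2n -addnn.
  by rewrite leq_add // mxrankS //; apply/row_subP=> i; rewrite row_mul;
    have /inW[] := row_sub i W.
by have := mxrank_mul_ker W (row_mx A B); lia.
Qed.

End IsotropicBound.

(** * The classification *)

Section Bounds.
Variables (R : realType) (n : nat) (H N : 'M[R]_n.+1).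
Hypotheses (nH : nonsingular_symmetric H) (iN : indecomposable H N)
  (norN : Hnormal H N) (k_gt0 : (0 < space_rank H)%N).
Local Notation ev p := (horner_mx N p).
Local Notation k := (space_rank H).
Implicit Types (x y : 'rV[R]_n.+1).

Lemma indefinite : exists x y, 0 < sprod H x x /\ sprod H y y < 0.
Proof.
have [_ [P [Q [Pf Qf PP QQ]]]] := inertia nH.
move: k_gt0; rewrite /space_rank leq_min => /andP[q0 p0].
have nz d (U : 'M[R]_(d, n.+1)) : row_free U -> (0 < d)%N ->
    exists2 x : 'rV_n.+1, (x <= U)%MS & x != 0.
  move=> Uf d0; have /rowV0Pn[x xU x0] : U != 0.
    by rewrite -mxrank_eq0 (eqP Uf) -lt0n.
  by exists x.
have [x xP x0] := nz _ _ Pf p0; have [y yQ y0] := nz _ _ Qf q0.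
by exists x, y; rewrite PP ?QQ.
Qed.

Lemma horner_comm_adj p q : ev p * hadj H (ev q) = hadj H (ev q) * ev p.
Proof.
rewrite hadj_horner //; apply: comm_horner_mx; apply: comm_mx_horner.
exact (Hnormal_adj nH norN).
Qed.

(* If [x, x] <> 0 then the span of x and x J is nondegenerate and invariant, hence the
   whole space, which would then be semidefinite. *)
Lemma joint_kernel_isotropic (g p : {poly R}) (u v w : R) (J := ev g) (A := ev p) x :
  N = u%:M + v *: J + A -> hadj H J = w *: J ->
  (forall a b, exists c, [/\ 0 <= c,
     sprod H (a *: x + b *: (x *m J)) (a *: x + b *: (x *m J)) = c * sprod H x x
     & c = 0 -> a *: x + b *: (x *m J) = 0]) ->
  (exists e, J * J = e%:M) ->
  x *m A = 0 -> x *m hadj H A = 0 -> sprod H x x = 0.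
Proof.
move=> NE J' cx [e JJ] xA xB; apply: contrapT => xx.
pose V := (x + x *m J)%MS.
have inV y : (y <= V)%MS -> exists a b, y = a *: x + b *: (x *m J).
  case/sub_addsmxP=> -[a b] /= ->; exists (a 0 0), (b 0 0).
  by rewrite {1}(mx11_scalar a) {1}(mx11_scalar b) !mul_scalar_mx.
have stV C : x *m C = 0 -> J * C = C * J -> forall v', stablemx V (u%:M + v' *: J + C).
  move=> xC JC v'; rewrite addsmxMr addsmx_sub !mulmxDr xC addr0.
  have -> : x *m J *m C = 0 by rewrite -mulmxA [J *m C]JC mulmxA xC mul0mx.
  rewrite addr0 !mul_mx_scalar -!scalemxAr -(mulmxA x) [J *m J]JJ mul_mx_scalar.
  by rewrite !addmx_sub // !scalemx_sub // ?addsmxSl ?addsmxSr.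
have fV : row_full V.
  apply: (indecomposable_stable nH iN).
  - apply: contra_not_neq xx => V0; have : (x <= V)%MS by exact: addsmxSl.
    by rewrite V0 submx0 => /eqP ->; rewrite sprod0l.
  - move=> y yV /(_ y yV); have [a [b ->]] := inV y yV; have [c [_ -> c0]] := cx a b.
    by move=> /eqP; rewrite mulf_eq0 => /orP[/eqP|/eqP] //.
  - rewrite NE; apply: stV => //; exact: comm_horner_mx2.
  - rewrite NE !hadjD (hadj_scalar nH) hadjZ J' scalerA; apply: stV => //.
    exact: horner_comm_adj.
have [p' [q' [p'0 q'0]]] := indefinite.
have [a [b p'E]] := inV p' (submx_full _ fV); have [c [c0 cE _]] := cx a b.
have [a' [b' q'E]] := inV q' (submx_full _ fV); have [c' [c'0 c'E _]] := cx a' b'.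
move: p'0 q'0; rewrite p'E q'E cE c'E => h1 h2.
have [xx0|xx0] := leP 0 (sprod H x x).
  by have := mulr_ge0 c'0 xx0; rewrite leNgt h2.
by have := mulr_ge0_le0 c0 (ltW xx0); rewrite leNgt h1.
Qed.

(** [isotropic_bound] with J = 1 and A = N - a; the exponent doubles because [conj_poly] of a real a
    is (X - a)^2. *)
Lemma bound_real_eigenvalue (a : R) m :
  ev (conj_poly a%:C%C ^+ m) = 0 -> (n.+1 <= 4 * k)%N.
Proof.
move=> Nm; pose p : {poly R} := 'X - a%:P.
have pE : conj_poly a%:C%C = p ^+ 2.
  by rewrite /conj_poly /p /= -mul_polyC; ring.
have NE : N = a%:M + 0 *: ev 1 + ev p.
  by rewrite scale0r addr0 /p rmorphB /= horner_mx_X horner_mx_C addrC subrK.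
have adj1 : hadj H 1 = 1 by exact: hadj_scalar.
have ev1 : ev 1 = 1 by rewrite rmorph1.
have [|||||||||L [L0 _ nL]] := @isotropic_bound R n H nH (ev p) 1 (2 * m) 1.
- exact: horner_comm_adj.
- by rewrite -rmorphXn exprM -pE.
- by rewrite mul1mx mulmx1.
- by rewrite mul1mx mulmx1.
- by move=> x y; rewrite !mulmx1.
- by rewrite mulmx1.
- by rewrite mulr1.
- by move=> x; rewrite mulmx1.
- move=> x; apply: (joint_kernel_isotropic (g := 1) NE (w := 1)).
  + by rewrite ev1 adj1 scale1r.
  + move=> c d; exists ((c + d) ^+ 2); rewrite sqr_ge0 ev1 mulmx1 -scalerDl; split=> //.
      by rewrite sprodZl sprodZr mulrA expr2.
    by move=> /eqP; rewrite expf_eq0 => /andP[_ /eqP ->]; rewrite scale0r.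
  + by exists 1; rewrite ev1 mulr1.
have := isotropic_rank nH (fun x xL => L0 x x xL xL); lia.
Qed.

(** The first alternative is J J^[*] = -1, where J reverses the sign of the form. In the second, J
    J^[*] = 1 and r is the rank of the isotropic subspace from [isotropic_bound], even because J
    acts on it. *)
Lemma bound_nonreal_pair (l : R[i]) m : nonreal l -> ev (conj_poly l ^+ m) = 0 ->
  n.+1 = (2 * k)%N \/
  exists2 r, (r <= k)%N & ~~ odd r /\ (n.+1 <= 4 * r)%N.
Proof.
move=> nrl Nm; have [g [JJ [m' Am]]] := complex_structure nrl Nm.
set J := ev g in JJ Am; pose J' := hadj H J.
have JcJ' : J * J' = J' * J by exact: horner_comm_adj.
have J'J' : J' * J' = -1.
  by rewrite -[LHS](hadjM nH) [J *m J]JJ (hadjN _ 1) (hadj_scalar nH).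
have [|||JJ'|JJ'] := indecomposable_idempotent nH iN (E := 2^-1 *: (1 + J * J')).
- rewrite -[LHS]/(_ * _) -scalerAl -scalerAr scalerA mulrDr mulr1 mulrDl mul1r.
  have -> : J * J' * (J * J') = 1.
    by rewrite {2}JcJ' mulrA -[J * J' * J']mulrA J'J' mulrN1 mulNr JJ opprK.
  rewrite [J * J' + 1]addrC -mulr2n -scaler_nat scalerA mulrAC mulfK ?pnatr_eq0 //.
- rewrite [LHS]hadjZ hadjD (hadj_scalar nH); congr (_ *: (_ + _)).
  by rewrite [LHS](hadjM nH) hadjK.
- rewrite -[LHS]/(_ * _) -[RHS]/(_ * _) -scalerAl -scalerAr mulrDl mulrDr mul1r mulr1.
  congr (_ *: (_ + _)); have NJ : N * J = J * N by have := comm_horner_mx2 N 'X g; rewrite horner_mx_X.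
  have NJ' : N * J' = J' * N by have := horner_comm_adj 'X g; rewrite horner_mx_X.
  by rewrite -[LHS]mulrA -NJ' [LHS]mulrA -NJ -mulrA.
- left; have {}JJ' : J * J' = -1.
    move/eqP: JJ'; rewrite scaler_eq0 invr_eq0 pnatr_eq0 /= addrC addr_eq0.
    by move/eqP.
  have J'E : J' = J.
    by apply: oppr_inj; rewrite -mulN1r -JJ -mulrA JJ' mulrN1.
  apply: (@space_rank_antiisometry _ _ _ J) => //.
    by case: (mulmx1_unit (_ : J *m (- J) = 1%:M)) => //; rewrite mulmxN [J *m J]JJ opprK.
  move=> x; rewrite (hadjPr nH) -/J' J'E -mulmxA [J *m J]JJ mulmxN mulmx1.
  by rewrite -scaleN1r sprodZr mulN1r.
- right; have {}JJ' : J * J' = 1.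
    have {}JJ' : 2^-1 *: (1 + J * J') = 1 by [].
    move/(congr1 ( *:%R 2)): JJ'; rewrite scalerA divff ?pnatr_eq0 // scale1r scaler_nat mulr2n.
    by move/addrI.
  have J'E : J' = - J.
    by rewrite -[LHS]mul1r -[1]opprK -JJ mulNr -mulrA JJ' mulr1.
  pose p : {poly R} := 'X - (complex.Re l)%:P - complex.Im l *: g.
  have Ap : ev p = N - (complex.Re l)%:M - complex.Im l *: J.
    by rewrite /p !rmorphB /= horner_mx_X horner_mx_C horner_mxZ.
  have NE : N = (complex.Re l)%:M + complex.Im l *: J + ev p.
    by rewrite Ap -[N - _ - _]addrA -opprD [RHS]addrC subrK.
  have isoJ x y : sprod H (x *m J) (y *m J) = sprod H x y.
    by rewrite (hadjPr nH) -mulmxA [J *m _]JJ' mulmx1.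
  have xJ x : sprod H x (x *m J) = 0.
    have [sH _] := nH; apply/eqP; rewrite -eqNr; apply/eqP.
    rewrite [RHS]sprodC // (hadjPr nH) -/J' J'E mulmxN -[- (x *m J)]scaleN1r.
    by rewrite sprodZr mulN1r.
  have [||||||||| L [L0 LJ nL]] := @isotropic_bound R n H nH (ev p) J m' (-1).
  - exact: horner_comm_adj.
  - by rewrite Ap.
  - exact: comm_horner_mx2.
  - exact: horner_comm_adj.
  - exact: isoJ.
  - by rewrite [LHS]JJ raddfN.
  - by rewrite mulrNN mulr1.
  - by move=> x _; exact: xJ.
  - move=> x; apply: (joint_kernel_isotropic (g := g) NE (w := -1)).
    + by rewrite scaleN1r.
    + move=> c d; exists (c ^+ 2 + d ^+ 2); have [sH _] := nH; split.
      * by rewrite addr_ge0 ?sqr_ge0.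
      * rewrite !(sprodDl, sprodDr, sprodZl, sprodZr) isoJ xJ (sprodC (x *m J) x sH) xJ.
        by rewrite !mulr0 addr0 add0r; ring.
      * move=> /eqP; rewrite paddr_eq0 ?sqr_ge0 // !expf_eq0 /= => /andP[/eqP -> /eqP ->].
        by rewrite !scale0r addr0.
    + by exists (-1); rewrite -/J JJ raddfN.
  exists (\rank L); first exact: isotropic_rank nH (fun x xL => L0 x x xL xL).
  split=> //; pose B := row_base L.
  have : stablemx B J by rewrite (eqmxMr _ (eq_row_base L)) eq_row_base.
  case/submxP=> K BK; apply: (complex_structure_even (J := K)).
  apply: (row_free_inj (row_base_free L)); rewrite -mulmxA -/B -BK mulmxA -BK.
  by rewrite -mulmxA [J *m J]JJ mulmxN mulNmx mulmx1 mul1mx.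
Qed.

Lemma exists_complex_eigenvalue : exists l, complex_eigenvalues N l.
Proof.
apply/closed_rootP; rewrite size_map_poly size_char_poly.
by [].
Qed.

Lemma nonreal_conj (l : R[i]) : nonreal l -> conjc l != l.
Proof.
case: l => a b; rewrite /nonreal /= eq_complex /= => b0.
by rewrite eqxx /= -subr_eq0 -opprD oppr_eq0 -mulr2n mulrn_eq0.
Qed.

Lemma real_of_nonreal (l : R[i]) : ~~ nonreal l -> l = (complex.Re l)%:C%C.
Proof. by case: l => a b; rewrite /nonreal /= negbK => /eqP ->. Qed.

Lemma nonreal_parity l l' : nonreal l -> l' != l -> l' != conjc l ->
  complex_eigenvalues N l -> complex_eigenvalues N l' -> ~~ odd k.
Proof.
move=> nrl l'l l'cl Nl Nl'; case: (spectral_type nH iN norN Nl) => [[m Nm]|].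
  have := annihilated_pair Nl Nm l'; rewrite !inE (negPf l'l) (negPf l'cl).
  by rewrite -[_ \in _]/(complex_eigenvalues N l') Nl'.
case=> E [m [EE E1 NE EN _]]; have [_ <-] := halves nH EE E1.
exact: nonreal_component_even nrl EE EN NE.
Qed.

Lemma classification :
  ((one_real_eigenvalue N /\ (2 * k <= n.+1 <= 4 * k)%N)
      \/ (two_real_eigenvalues N /\ n.+1 = (2 * k)%N)
      \/ (one_nonreal_pair N /\
          (k = 1%N -> n.+1 = 2%N) /\
          ((1 < k)%N -> (2 * k <= n.+1 <= 10 * k./2 - 2)%N))
      \/ (one_real_one_nonreal_pair N /\ n.+1 = (2 * k)%N)
      \/ (two_nonreal_pairs N /\ n.+1 = (2 * k)%N))
     /\ (one_real_one_nonreal_pair N -> ~~ odd k)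
     /\ (two_nonreal_pairs N -> ~~ odd k).
Proof.
split; last first.
  split=> [[a [l [nrl Nal]]]|[l [l' [nrl nrl' l'l l'cl Nl]]]]; last first.
    by apply: (nonreal_parity nrl l'l l'cl); [have := Nl l | have := Nl l'];
      rewrite !inE eqxx ?orbT.
  have [al acl] : a%:C%C != l /\ a%:C%C != conjc l.
    move: nrl; case: (l) => c d; rewrite /nonreal !eq_complex /= => d0.
    by rewrite ![0 == _]eq_sym oppr_eq0 (negPf d0) !andbF.
  by apply: (nonreal_parity nrl al acl); [have := Nal l | have := Nal a%:C%C];
      rewrite !inE eqxx ?orbT.
have le2k := space_rank_le nH.
have [l Nl] := exists_complex_eigenvalue.
case: (spectral_type nH iN norN Nl) => [[m Nm]|[E [m [EE E1 NE EN]]]].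
  have El := annihilated_pair Nl Nm.
  have [nrl|/real_of_nonreal rl] := boolP (nonreal l).
    right; right; left; split; first by exists l.
    case: (bound_nonreal_pair nrl Nm) => [nk|[r rk [r_even n4r]]].
      by split=> [k1|k1]; [rewrite nk k1 | lia].
    by split=> [k1|k1]; lia.
  left; split; last by rewrite le2k; apply: (@bound_real_eigenvalue (complex.Re l) m); rewrite -rl.
  have cl : conjc l = l by rewrite rl conjc_real.
  by exists (complex.Re l) => z; rewrite El cl -rl !inE orbb.
case=> l' [Nl' l'l l'cl El]; have [nk _] := halves nH EE E1.
have [nrl|/real_of_nonreal rl] := boolP (nonreal l).
  have [nrl'|/real_of_nonreal rl'] := boolP (nonreal l').
    by right; right; right; right; split=> //; exists l, l'.
  right; right; right; left; split=> //; exists (complex.Re l'), l; split=> // z.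
  have cl' : conjc l' = l' by rewrite rl' conjc_real.
  rewrite El cl' !inE -rl'; by case: (z == l); case: (z == conjc l); case: (z == l').
have cl : conjc l = l by rewrite rl conjc_real.
have [nrl'|/real_of_nonreal rl'] := boolP (nonreal l').
  right; right; right; left; split=> //; exists (complex.Re l), l'; split=> // z.
  rewrite El cl !inE -rl; by case: (z == l); case: (z == conjc l'); case: (z == l').
right; left; split=> //; exists (complex.Re l), (complex.Re l').
have cl' : conjc l' = l' by rewrite rl' conjc_real.
split; first by apply: contra_neq l'l => e; rewrite rl rl' e.
by move=> z; rewrite El cl cl' !inE -rl -rl'; case: (z == l); case: (z == l').
Qed.

End Bounds.

(** * Cyclic operators and examples with n = 2k *)

Lemma indecomposable_criterion (R : realType) (n : nat) (H N : 'M[R]_n) :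
  nonsingular_symmetric H ->
  (forall E : 'M[R]_n, E *m E = E -> E *m N = N *m E ->
     E *m hadj H N = hadj H N *m E -> hadj H E = E -> E = 0 \/ E = 1%:M) ->
  indecomposable H N.
Proof.
move=> nH crit [V [[V0 ndV] nfV VN VpN]].
have [sH uH] := nH; pose W := perp H V.
have inW x : (x <= W)%MS <-> in_perp H V x by split=> [/perpP|/perpP].
have VW0 : (V :&: W)%MS = 0.
  by apply/eqP/rowV0P=> x; rewrite sub_capmx => /andP[xV /inW xW]; exact: ndV.
have VW1 (x : 'rV_n) : (x <= V + W)%MS.
  apply: submx_full; rewrite /row_full mxrank_disjoint_sum // rank_perp //.
  by rewrite subnKC ?rank_leq_col.
pose E := proj_mx V W; pose F := proj_mx W V.
have EV (x : 'rV_n) : (x *m E <= V)%MS by exact: proj_mx_sub.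
have FW (x : 'rV_n) : (x *m F <= W)%MS by exact: proj_mx_sub.
have EF (x : 'rV_n) : x *m E + x *m F = x by exact: add_proj_mx.
have Eid (x : 'rV_n) : (x <= V)%MS -> x *m E = x by exact: proj_mx_id.
have E0 (x : 'rV_n) : (x <= W)%MS -> x *m E = 0 by exact: proj_mx_0.
clearbody E F.
have eqP' (A B : 'M[R]_n) : (forall x : 'rV_n, x *m A = x *m B) -> A = B.
  by move=> AB; apply/row_matrixP=> i; rewrite !rowE.
have selfE x y : sprod H (x *m E) y = sprod H x (y *m E).
  rewrite -{1}(EF y) -{2}(EF x) sprodDr sprodDl.
  have /inW/(_ _ (EV y)) -> := FW x.
  have /inW/(_ _ (EV x)) := FW y; rewrite sprodC // => ->.
  by rewrite !addr0.
have EN : E *m N = N *m E.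
  apply: eqP' => x; rewrite !mulmxA -[x in RHS](EF x) !mulmxDl.
  rewrite (E0 (x *m F *m N)) ?addr0; last exact/inW/VpN/inW.
  by rewrite (Eid (x *m E *m N)) // (submx_trans (submxMr _ (EV x))).
have hE : hadj H E = E by apply/esym/(is_adjointE E E nH); exact: selfE.
have [||||E_0|E_1] := crit E.
- by apply: eqP' => x; rewrite mulmxA [LHS]Eid.
- exact: EN.
- by rewrite -{1}hE -(hadjM nH) -EN (hadjM nH) hE.
- exact: hE.
- case/negP: V0; apply/eqP/row_matrixP=> i; rewrite row0.
  by rewrite -(Eid _ (row_sub i V)) E_0 mulmx0.
- case/negP: nfV; rewrite -sub1mx; apply/row_subP=> i; rewrite -[row i _]mulmx1 -E_1; exact: EV.
Qed.

Definition prime_like (F : fieldType) (q : {poly F}) :=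
  forall g, coprimep q g \/ q %| g.

Lemma prime_like_XsubC (F : fieldType) (a : F) : prime_like ('X - a%:P).
Proof.
move=> g; have [ga|ga] := boolP (root g a); first by right; rewrite dvdp_XsubCl.
by left; rewrite coprimep_sym coprimep_XsubC.
Qed.

Lemma prime_like_conj_poly (R : realType) (l : R[i]) :
  nonreal l -> prime_like (conj_poly l).
Proof.
move=> nrl g; have [gl|gl] := boolP (root (map_poly (real_complex R) g) l).
  right; rewrite -(dvdp_map (real_complex R)) toC_conj_poly Gauss_dvdp.
    by rewrite !dvdp_XsubCl gl root_toC_conj.
  by rewrite coprimep_XsubC root_XsubC nonreal_conj.
left; rewrite -(coprimep_map (real_complex R)).
apply: Pdiv.ClosedField.root_coprimep => x; rewrite root_toC_conj_poly -rootE.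
by case/orP=> /eqP ->; rewrite ?root_toC_conj.
Qed.

Section Cyclic.
Variables (F : fieldType) (n : nat).
Implicit Types (f g q : {poly F}) (C E : 'M[F]_n.+1).

Lemma companion f : f \is monic -> size f = n.+2 ->
  exists C, char_poly C = f /\
    forall i : 'I_n.+1, delta_mx 0 0 *m C ^+ i = delta_mx 0 i :> 'rV_n.+1.
Proof.
move=> mf sf.
have : exists C : 'M[F]_((size f).-1), char_poly C = f /\
   forall (i : 'I_((size f).-1)) (h : (i.+1 < (size f).-1)%N),
     delta_mx 0 i *m C = delta_mx 0 (Ordinal h) :> 'rV__.
  exists (companionmx f); split; first exact: companionmxK.
  by move=> i h; apply: mulmx_delta_companion.
rewrite sf /= => -[C [cC CS]]; exists C; split=> // -[i hi] /=.
elim: i hi => [|i IHi] hi.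
  by rewrite mulmx1; congr (delta_mx 0 _); apply: val_inj.
have hi' : (i < n.+1)%N by exact: ltnW.
by rewrite exprSr [_ *m _]mulmxA (IHi hi') (CS (Ordinal hi') hi).
Qed.

Section CyclicVector.
Variables (C : 'M[F]_n.+1) (f : {poly F}).
Hypotheses (cC : char_poly C = f)
  (CS : forall i : 'I_n.+1, delta_mx 0 0 *m C ^+ i = delta_mx 0 i :> 'rV_n.+1).
Local Notation v := (delta_mx 0 0 : 'rV[F]_n.+1).

Lemma cyclic_small g : (size g <= n.+1)%N -> v *m horner_mx C g = poly_rV g.
Proof.
move=> sg; rewrite -[in LHS](take_poly_id sg) /take_poly poly_def.
rewrite linear_sum mulmx_sumr; apply/rowP=> j.
rewrite summxE (bigD1 j) //= big1 => [|i /negPf ij]; last first.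
  by rewrite horner_mxZ rmorphXn /= horner_mx_X -scalemxAr CS !mxE eqxx eq_sym ij mulr0.
by rewrite horner_mxZ rmorphXn /= horner_mx_X -scalemxAr CS !mxE !eqxx mulr1 addr0.
Qed.

Let sf : size f = n.+2.
Proof. by rewrite -cC size_char_poly. Qed.

Let mf : f \is monic.
Proof. by rewrite -cC char_poly_monic. Qed.

Let f0 : f != 0. Proof. exact: monic_neq0. Qed.

Lemma cyclic_mod g : horner_mx C g = horner_mx C (g %% f).
Proof.
rewrite {1}(divp_eq g f) rmorphD rmorphM /= -[in horner_mx C f]cC.
by rewrite Cayley_Hamilton mulr0 add0r.
Qed.

Lemma cyclic_horner g : v *m horner_mx C g = poly_rV (g %% f).
Proof. by rewrite cyclic_mod cyclic_small // -ltnS -sf ltn_modp. Qed.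

Lemma cyclic_vector (x : 'rV[F]_n.+1) : x = v *m horner_mx C (rVpoly x).
Proof. by rewrite cyclic_small ?size_poly // rVpolyK. Qed.

Lemma cyclic_commutant E : E *m C = C *m E -> exists g, E = horner_mx C g.
Proof.
move=> EC; exists (rVpoly (v *m E)); set g := rVpoly _.
apply/row_matrixP=> i; rewrite !rowE -CS -!mulmxA.
have comm h : E *m horner_mx C h = horner_mx C h *m E by apply: comm_mx_horner.
have -> : C ^+ i = horner_mx C ('X^i) by rewrite rmorphXn /= horner_mx_X.
rewrite -comm mulmxA (cyclic_vector (v *m E)) -/g -!mulmxA; congr (_ *m _).
exact: comm_horner_mx2.
Qed.

Lemma cyclic_idempotent q m E : prime_like q -> f = q ^+ m ->
  E *m C = C *m E -> E *m E = E -> E = 0 \/ E = 1%:M.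
Proof.
move=> pq fq /cyclic_commutant[g ->] EE.
have Ef : horner_mx C f = 0 by rewrite -[in horner_mx C f]cC Cayley_Hamilton.
case: (pq g) => [cop|/dvdpP[h gE]].
  right; have /Bezout_eq1_coprimepP[[u w] /= uw] : coprimep f g.
    by rewrite fq coprimep_expl.
  have inv : horner_mx C w * horner_mx C g = 1.
    by rewrite -(rmorph1 (horner_mx C)) -uw rmorphD !rmorphM /= Ef mulr0 add0r.
  have EE' : horner_mx C g * horner_mx C g = horner_mx C g by [].
  by rewrite -[LHS]mul1r -inv -mulrA EE'.
left; have Em : forall i, horner_mx C g ^+ i.+1 = horner_mx C g.
  by elim=> // i IHi; rewrite exprS IHi; exact: EE.
by rewrite -(Em m) exprSr -rmorphXn gE exprMn -fq !rmorphM /= Ef mulr0 mul0r.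
Qed.

End CyclicVector.
End Cyclic.

Section Hankel.
Variables (R : realType) (n : nat) (C : 'M[R]_n.+1) (f : {poly R}).
Hypotheses (cC : char_poly C = f)
  (CS : forall i : 'I_n.+1, delta_mx 0 0 *m C ^+ i = delta_mx 0 i :> 'rV_n.+1).
Local Notation v := (delta_mx 0 0 : 'rV[R]_n.+1).
Implicit Types (g h : {poly R}) (x y : 'rV[R]_n.+1).

Definition top_coef g : R := (g %% f)`_n.

Lemma top_coefD g h : top_coef (g + h) = top_coef g + top_coef h.
Proof. by rewrite /top_coef modpD coefD. Qed.

Lemma top_coefZ a g : top_coef (a *: g) = a * top_coef g.
Proof. by rewrite /top_coef modpZl coefZ. Qed.

Lemma top_coef_sum (I : Type) (r : seq I) (P : pred I) (F : I -> {poly R}) :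
  top_coef (\sum_(i <- r | P i) F i) = \sum_(i <- r | P i) top_coef (F i).
Proof.
by apply: (big_morph top_coef top_coefD); rewrite /top_coef mod0p coef0.
Qed.

(* The form (g, h) |-> top_coef (g h) on R[X]/(f), in the basis of monomials. *)
Definition hankel : 'M[R]_n.+1 := \matrix_(i, j) top_coef 'X^(i + j).

Let sf : size f = n.+2.
Proof. by rewrite -cC size_char_poly. Qed.

Let f0 : f != 0. Proof. by rewrite -size_poly_eq0 sf. Qed.

Lemma top_coef_small g : (size g <= n.+1)%N -> top_coef g = g`_n.
Proof. by move=> sg; rewrite /top_coef modp_small // sf. Qed.

Lemma rVpolyE x : rVpoly x = \sum_(i < n.+1) x 0 i *: 'X^i.
Proof. by rewrite /rVpoly poly_def; apply: eq_bigr => i _; rewrite valK. Qed.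

Lemma sprod_hankel x y : sprod hankel x y = top_coef (rVpoly x * rVpoly y).
Proof.
rewrite sprodE !rVpolyE mulr_sumr top_coef_sum mxE; apply: eq_bigr => j _.
rewrite mulr_suml top_coef_sum !mxE mulr_suml; apply: eq_bigr => i _.
by rewrite -scalerAl -scalerAr !top_coefZ -exprD mxE; ring.
Qed.

Lemma sprod_hankel_horner g h :
  sprod hankel (v *m horner_mx C g) (v *m horner_mx C h) = top_coef (g * h).
Proof.
have sm (p : {poly R}) : (size (p %% f)%R <= n.+1)%N by rewrite -ltnS -sf ltn_modp.
rewrite sprod_hankel !(cyclic_horner cC CS) !poly_rV_K //.
by rewrite /top_coef modp_mul mulrC modp_mul mulrC.
Qed.

Lemma hankel_nonsingular : nonsingular_symmetric hankel.
Proof.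
split; first by apply/matrixP=> i j; rewrite !mxE addnC.
rewrite -row_free_unit -kermx_eq0; apply/rowV0P=> x /sub_kermxP xH.
apply/eqP; case: eqP => // /eqP x0; have g0 : rVpoly x != 0.
  by apply: contraNneq x0 => g0; rewrite -[x]rVpolyK g0 linear0.
have sg : (0 < size (rVpoly x) <= n.+1)%N by rewrite size_poly_gt0 g0 size_poly.
have : top_coef (rVpoly x * 'X^(n.+1 - size (rVpoly x))) = 0.
  rewrite -(sprod_hankel_horner _ 'X^_) -(cyclic_vector CS) sprodE.
  by rewrite xH mul0mx mxE.
have sgX : size (rVpoly x * 'X^(n.+1 - size (rVpoly x))) = n.+1.
  by rewrite size_mulXn //; lia.
rewrite top_coef_small ?sgX // coefMXn ifF; last by lia.
have -> : (n - (n.+1 - size (rVpoly x)) = (size (rVpoly x)).-1)%N by lia.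
by move/eqP; rewrite -/(lead_coef _) lead_coef_eq0 (negPf g0).
Qed.

Lemma hankel_selfadjoint : hadj hankel C = C.
Proof.
apply/esym/(is_adjointE C C hankel_nonsingular) => x y.
rewrite (cyclic_vector CS x) (cyclic_vector CS y).
have hX g : v *m horner_mx C g *m C = v *m horner_mx C (g * 'X).
  by rewrite rmorphM /= horner_mx_X mulmxA.
by rewrite !hX !sprod_hankel_horner; congr top_coef; ring.
Qed.

Lemma hankel_rank k : n.+1 = (2 * k)%N -> space_rank hankel = k.
Proof.
move=> nk; pose U : 'M[R]_(k, n.+1) := pid_mx k.
have rU : \rank U = k by rewrite rank_pid_mx //; lia.
have U0 x : (x <= U)%MS -> sprod hankel x x = 0.
  case/submxP=> u xu; have sx : (size (rVpoly x) <= k)%N.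
    apply/leq_sizeP=> j kj; rewrite coef_rVpoly; case: insubP => // i _ ij.
    rewrite xu mxE big1 // => l _; rewrite mxE ij.
    by rewrite (_ : (l == j :> nat) = false) ?mulr0 //; apply/eqP; have := ltn_ord l; lia.
  have ss : (size (rVpoly x * rVpoly x)%R <= n)%N.
    apply: leq_trans (size_polyMleq _ _) _; lia.
  by rewrite sprod_hankel top_coef_small ?nth_default // ltnW.
rewrite (space_rankP hankel_nonsingular U0 (W := U)) ?rU //; last by lia.
by move=> x xU; rewrite U0.
Qed.

Lemma hankel_indecomposable q m k : prime_like q -> f = q ^+ m ->
  n.+1 = (2 * k)%N -> indecomposable_normal k hankel C.
Proof.
move=> pq fq nk; split; first exact: hankel_nonsingular.
- exact: hankel_rank.
- by exists C => //; apply/(is_adjointE _ _ hankel_nonsingular); exact/esym/hankel_selfadjoint.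
apply: (indecomposable_criterion hankel_nonsingular) => E EE EC _ _.
exact: cyclic_idempotent pq fq EC EE.
Qed.

End Hankel.

Lemma cyclic_example (R : realType) (q : {poly R}) m k : (0 < k)%N -> q \is monic ->
  prime_like q -> size (q ^+ m) = (2 * k).+1 ->
  exists H N : 'M[R]_(2 * k), indecomposable_normal k H N /\ char_poly N = q ^+ m.
Proof.
move=> k0 mq pq; have [n nk] : exists n, (2 * k)%N = n.+1 by exists (2 * k).-1; lia.
rewrite nk => sq; have [C [cC CS]] := companion (monic_exp m mq) sq.
exists (hankel n (q ^+ m)), C; split=> //.
exact: (hankel_indecomposable cC CS pq (erefl _)).
Qed.

Lemma one_real_eigenvalue_2k (R : realType) k : (0 < k)%N ->
  attained k (@one_real_eigenvalue R (2 * k)).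
Proof.
move=> k0; have [|H [N [HN cN]]] := cyclic_example (m := 2 * k) k0 (monicXsubC 0) (prime_like_XsubC (F := R) 0).
  by rewrite size_exp_XsubC.
exists H, N; split=> //; exists 0 => z; rewrite inE -[_ \in _]/(root _ _) cN.
rewrite rmorphXn /= map_polyXsubC /root horner_exp expf_eq0 hornerXsubC subr_eq0.
by rewrite muln_gt0 k0.
Qed.

Lemma size_conj_polyX (R : realType) (l : R[i]) m : size (conj_poly l ^+ m) = (2 * m).+1.
Proof.
rewrite -(size_map_poly (real_complex R)) rmorphXn /= toC_conj_poly exprMn size_Mmonic.
- by rewrite !size_exp_XsubC; lia.
- by rewrite -size_poly_eq0 size_exp_XsubC.
- by rewrite monic_exp // monicXsubC.
Qed.

Lemma conj_poly_monic (R : realType) (l : R[i]) : conj_poly l \is monic.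
Proof.
rewrite -(map_monic (real_complex R)) toC_conj_poly monicMl ?monicXsubC //.
Qed.

Lemma nonreal_i (R : realType) : nonreal ('i%C : R[i]).
Proof. by rewrite /nonreal /= oner_eq0. Qed.

Lemma one_nonreal_pair_2k (R : realType) k : (0 < k)%N ->
  attained k (@one_nonreal_pair R (2 * k)).
Proof.
move=> k0; have [|H [N [HN cN]]] := cyclic_example (m := k) k0
  (@conj_poly_monic R 'i%C) (prime_like_conj_poly (nonreal_i R)).
  by rewrite size_conj_polyX.
exists H, N; split=> //; exists 'i%C; split; first exact: nonreal_i.
move=> z; rewrite !inE -[_ \in _]/(root _ _) cN rmorphXn /root horner_exp expf_eq0 k0.
by rewrite -[_ == 0]/(root _ _) root_toC_conj_poly.
Qed.

Section Hyperbolic.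
Variables (R : realType) (k : nat) (X : 'M[R]_k) (c : R).
Hypotheses (Xu : X \in unitmx) (c2 : c ^+ 2 != 1).

Definition hyperbolic_form : 'M[R]_(k + k) := block_mx 0 1%:M 1%:M 0.
Definition hyperbolic_mx : 'M[R]_(k + k) := block_mx X 0 0 (c *: X^T).
Local Notation H := hyperbolic_form.
Local Notation N := hyperbolic_mx.

Let blockE := (mulmx_block, mul0mx, mulmx0, mul1mx, mulmx1, addr0, add0r).

Lemma hyperbolic_form_sqr : H *m H = 1%:M.
Proof. by rewrite /H !blockE -scalar_mx_block. Qed.

Lemma hyperbolic_form_nonsingular : nonsingular_symmetric H.
Proof.
split; first by rewrite /H tr_block_mx !trmx0 !trmx1.
by case: (mulmx1_unit hyperbolic_form_sqr).
Qed.

Lemma hadj_hyperbolic A : hadj H A = H *m A^T *m H.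
Proof.
rewrite /hadj; congr (_ *m _); have [_ uH] := hyperbolic_form_nonsingular.
by rewrite -[LHS]mul1mx -hyperbolic_form_sqr -mulmxA mulmxV // mulmx1.
Qed.

Lemma hadj_hyperbolic_block A B C D :
  hadj H (block_mx A B C D) = block_mx D^T B^T C^T A^T.
Proof. by rewrite hadj_hyperbolic tr_block_mx /H !blockE. Qed.

Lemma hyperbolic_rank : space_rank H = k.
Proof.
pose U : 'M[R]_(k, k + k) := row_mx 1%:M 0.
have rU : \rank U = k by rewrite rank_row_mx0 mxrank1.
have U0 x : (x <= U)%MS -> sprod H x x = 0.
  move=> xU; have : U *m H *m U^T = 0.
    by rewrite /H mul_row_block tr_row_mx mul_row_col !blockE trmx0.
  by move/sprod_mx0; apply.
rewrite (space_rankP hyperbolic_form_nonsingular U0 (W := U)) ?rU //.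
by move=> x xU; rewrite U0.
Qed.

Lemma hyperbolic_indecomposable :
  (forall e : 'M[R]_k, e *m X = X *m e -> e *m e = e -> e = 0 \/ e = 1%:M) ->
  indecomposable_normal k H N.
Proof.
move=> idX; have nH := hyperbolic_form_nonsingular.
have hN : hadj H N = block_mx (c *: X) 0 0 X^T.
  by rewrite hadj_hyperbolic_block !trmx0 linearZ /= trmxK.
split=> //; first exact: hyperbolic_rank.
  exists (hadj H N); first exact/(is_adjointE _ _ nH).
  by rewrite hN /N !blockE -!scalemxAl -!scalemxAr.
apply: indecomposable_criterion => // E; rewrite -[E]submxK.
move: (ulsubmx E) (ursubmx E) (dlsubmx E) (drsubmx E) => e a b d.
rewrite hN hadj_hyperbolic_block /N !mulmx_block !(mulmx0, mul0mx, addr0, add0r).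
move=> /eq_block_mx[ee _ _ _] /eq_block_mx[eX aN bN _] /eq_block_mx[_ aM bM _].
case/eq_block_mx=> dE _ _ _.
have c1 : 1 - c ^+ 2 != 0 by rewrite subr_eq0 eq_sym.
have a0 : a = 0.
  have : (1 - c ^+ 2) *: (a *m X^T) = 0.
    have -> : (1 - c ^+ 2) *: (a *m X^T) = a *m X^T - c *: (X *m a).
      by rewrite scalerBl scale1r -aN -scalemxAr scalerA expr2.
    by rewrite aM -scalemxAl subrr.
  move/eqP; rewrite scaler_eq0 (negPf c1) /= => /eqP aX.
  by rewrite -[a](mulmxK (_ : X^T \in unitmx)) ?unitmx_tr // aX mul0mx.
have b0 : b = 0.
  have : (1 - c ^+ 2) *: (X^T *m b) = 0.
    have -> : (1 - c ^+ 2) *: (X^T *m b) = X^T *m b - c *: (b *m X).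
      by rewrite scalerBl scale1r bN -scalemxAl scalerA expr2.
    by rewrite -bM -scalemxAr subrr.
  move/eqP; rewrite scaler_eq0 (negPf c1) /= => /eqP aX.
  by rewrite -[b](mulKmx (_ : X^T \in unitmx)) ?unitmx_tr // aX mulmx0.
rewrite a0 b0 in ee *; rewrite mulmx0 addr0 in ee.
have [e0|e1] := idX e eX ee.
  have d0 : d = 0 by apply: trmx_inj; rewrite dE e0 trmx0.
  by left; rewrite e0 d0 block_mx0.
have d1 : d = 1%:M by apply: trmx_inj; rewrite dE e1 trmx1.
by right; rewrite e1 d1 -scalar_mx_block.
Qed.

Lemma eigenvalues_hyperbolic z : complex_eigenvalues N z =
  complex_eigenvalues X z || complex_eigenvalues (c *: X) z.
Proof.
rewrite /complex_eigenvalues -rootM -rmorphM /=; congr (root (map_poly _ _) _).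
rewrite /N {1}/char_poly char_block_diag_mx det_ublock; congr (_ * _).
rewrite /char_poly -[RHS]det_tr /char_poly_mx [in RHS]linearB /= tr_scalar_mx.
by rewrite map_trmx [in RHS]linearZ.
Qed.

End Hyperbolic.

Lemma eigenvalues_scale (R : realType) n (X : 'M[R]_n) c z : c != 0 ->
  complex_eigenvalues (c *: X) z = complex_eigenvalues X (z / c%:C%C).
Proof.
move=> c0; have c0' : c%:C%C != 0 by rewrite -(inj_eq (@complexI R)) in c0.
rewrite /complex_eigenvalues !map_char_poly -!eigenvalue_root_char map_mxZ /=.
apply/eigenvalueP/eigenvalueP => -[v vX v0]; exists v => //.
  by apply: (scalerI c0'); rewrite scalemxAr vX scalerA mulrCA mulfV // mulr1.
by rewrite -scalemxAr vX scalerA mulrCA mulfV // mulr1.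
Qed.

Lemma eigenvalues_zero (R : realType) n z : complex_eigenvalues (0 : 'M[R]_n.+1) z = (z == 0).
Proof.
rewrite /complex_eigenvalues; have -> : char_poly (0 : 'M[R]_n.+1) = 'X^(n.+1).
  by rewrite /char_poly /char_poly_mx map_mx0 subr0 det_scalar.
by rewrite map_polyXn /root hornerXn expf_eq0.
Qed.

Lemma hyperbolic_example (R : realType) (q : {poly R}) m k c : (0 < k)%N ->
  q \is monic -> prime_like q -> size (q ^+ m) = k.+1 -> ~~ root q 0 -> c ^+ 2 != 1 ->
  exists H N : 'M[R]_(2 * k), indecomposable_normal k H N /\
    forall z, complex_eigenvalues N z = root (map_poly (real_complex R) (q ^+ m)) z ||
      if c == 0 then z == 0 else root (map_poly (real_complex R) (q ^+ m)) (z / c%:C%C).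
Proof.
rewrite mul2n -addnn; case: k => // k _ mq pq sq q0 c2.
have [C [cC CS]] := companion (monic_exp m mq) sq.
have Cu : C \in unitmx.
  have : (char_poly C)`_0 != 0.
    rewrite cC -horner_coef0 horner_exp expf_eq0 negb_and.
    by rewrite [q.[0] == 0](negPf q0) orbT.
  by rewrite char_poly_det mulf_eq0 signr_eq0 unitmxE unitfE.
exists (hyperbolic_form R k.+1), (hyperbolic_mx C c); split.
  apply: hyperbolic_indecomposable => // e eC ee.
  exact: (cyclic_idempotent cC CS pq (erefl _) eC ee).
move=> z; rewrite eigenvalues_hyperbolic; congr (_ || _).
  by rewrite /complex_eigenvalues cC.
have [->|c0] := eqVneq c 0; first by rewrite scale0r eigenvalues_zero.
by rewrite eigenvalues_scale // /complex_eigenvalues cC.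
Qed.

Lemma root_conj_polyX (R : realType) (l : R[i]) m z : (0 < m)%N ->
  root (map_poly (real_complex R) (conj_poly l ^+ m)) z = (z == l) || (z == conjc l).
Proof.
move=> m0; rewrite -root_toC_conj_poly rmorphXn /= /root horner_exp expf_eq0 m0.
by [].
Qed.

Lemma conj_poly_i_root0 (R : realType) : ~~ root (conj_poly ('i%C : R[i])) 0.
Proof.
rewrite /root /conj_poly /= mulr0 scale0r subr0 expr0n add0r expr1n hornerD hornerXn hornerC.
by rewrite expr0n add0r oner_eq0.
Qed.

Lemma two_real_eigenvalues_2k (R : realType) k : (0 < k)%N ->
  attained k (@two_real_eigenvalues R (2 * k)).
Proof.
move=> k0; have [|||H [N [HN cN]]] := hyperbolic_example (m := k) (c := 0) k0
  (monicXsubC 1) (prime_like_XsubC (F := R) 1).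
- by rewrite size_exp_XsubC.
- by rewrite root_XsubC eq_sym oner_eq0.
- by rewrite expr0n eq_sym oner_eq0.
exists H, N; split=> //; exists 1, 0; split; first exact: oner_neq0.
move=> z; rewrite !inE -[_ \in _]/(complex_eigenvalues N z) cN eqxx.
rewrite rmorphXn /= map_polyXsubC /root horner_exp expf_eq0 hornerXsubC subr_eq0.
by rewrite k0.
Qed.

Lemma one_real_one_nonreal_pair_2k (R : realType) k : (0 < k)%N -> ~~ odd k ->
  attained k (@one_real_one_nonreal_pair R (2 * k)).
Proof.
move=> k0 ek; have [|||H [N [HN cN]]] := hyperbolic_example (m := k./2) (c := 0) k0
  (@conj_poly_monic R 'i%C) (prime_like_conj_poly (nonreal_i R)).
- by rewrite size_conj_polyX mul2n even_halfK.
- exact: conj_poly_i_root0.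
- by rewrite expr0n eq_sym oner_eq0.
exists H, N; split=> //; exists 0, 'i%C; split; first exact: nonreal_i.
move=> z; rewrite !inE -[_ \in _]/(complex_eigenvalues N z) cN eqxx.
by rewrite root_conj_polyX; [exact: orbC | lia].
Qed.

Lemma two_nonreal_pairs_2k (R : realType) k : (0 < k)%N -> ~~ odd k ->
  attained k (@two_nonreal_pairs R (2 * k)).
Proof.
move=> k0 ek; have [|||H [N [HN cN]]] := hyperbolic_example (m := k./2) (c := 2) k0
  (@conj_poly_monic R 'i%C) (prime_like_conj_poly (nonreal_i R)).
- by rewrite size_conj_polyX mul2n even_halfK.
- exact: conj_poly_i_root0.
- by apply/eqP; lra.
have c0 : 2%:C%C != 0 :> R[i] by rewrite fmorph_eq0 pnatr_eq0.
exists H, N; split=> //; exists 'i%C, (Complex 0 2); split.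
- exact: nonreal_i.
- by rewrite /nonreal /= pnatr_eq0.
- by rewrite eq_complex /= eqxx /= -subr_eq0 [_ - _](_ : _ = 1) ?oner_eq0 //; ring.
- by rewrite eq_complex /= eqxx /= -subr_eq0 [_ - _](_ : _ = 3) ?pnatr_eq0 //; ring.
move=> z; rewrite !inE -[_ \in _]/(complex_eigenvalues N z) cN pnatr_eq0 /=.
have scale2 y : (z / 2%:C%C == y) = (z == y * 2%:C%C).
  by apply/eqP/eqP => [<-|->]; rewrite ?divfK ?mulfK.
rewrite !root_conj_polyX; [|lia..]; rewrite !scale2 -orbA.
have -> : ('i * 2%:C = Complex 0 2 :> R[i])%C.
  by apply/eqP; rewrite eq_complex /=; apply/andP; split; apply/eqP; ring.
have -> // : (conjc 'i * 2%:C = conjc (Complex 0 2) :> R[i])%C.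
by apply/eqP; rewrite eq_complex /=; apply/andP; split; apply/eqP; ring.
Qed.

(** * The example with n = 4k *)

Section FourBlocks.
Variables (R : realType) (k : nat) (K : 'M[R]_k).
Hypothesis contrK : forall a : 'rV[R]_k, dotv (a *m K) (a *m K) <= dotv a a.
Implicit Types (a b d l : 'rV[R]_k).

(* Blocks L', T1, T2, L: the form pairs L' with L and is positive definite on T1 + T2;
   N and its adjoint map L' onto T1 and T2 respectively, and T1 + T2 into L.
   N^2 and N N* carry L' to L by K and 2, so that an operator commuting with both
   restricts on L' to one commuting with K. *)
Definition four_form : 'M[R]_((k + k) + (k + k)) :=
  block_mx (block_mx 0 0 0 2%:M) (block_mx 0 1%:M K 0)
           (block_mx 0 K^T 1%:M 0) (block_mx 2%:M 0 0 0).
Definition four_mx : 'M[R]_((k + k) + (k + k)) :=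
  block_mx (block_mx 0 1%:M 0 0) (block_mx 0 0 0 K) 0 (block_mx 0 2%:M 0 0).
Definition four_adj : 'M[R]_((k + k) + (k + k)) :=
  block_mx 0 (block_mx 1%:M 0 0 2%:M) 0 (block_mx 0 K^T 0 0).
Local Notation H := four_form.
Local Notation N := four_mx.
Local Notation M := four_adj.

Let zeroE := (mul0mx, mulmx0, mul1mx, mulmx1, addr0, add0r).

Lemma dotvDl a b d : dotv (a + b) d = dotv a d + dotv b d.
Proof. by rewrite /dotv mulmxDl mxE. Qed.

Lemma dotvC a b : dotv a b = dotv b a.
Proof. by rewrite /dotv !mxE; apply: eq_bigr => i _; rewrite !mxE mulrC. Qed.

Lemma dotv_tr a b : dotv (b *m K^T) a = dotv (a *m K) b.
Proof. by rewrite [RHS]dotvC /dotv trmx_mul mulmxA. Qed.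

Lemma four_form_mul l a b d :
  row_mx (row_mx l a) (row_mx b d) *m H =
  row_mx (row_mx d (2 *: a + b *m K^T)) (row_mx (a *m K + 2 *: b) l).
Proof.
rewrite /H mul_row_block !mul_row_block !zeroE !add_row_mx !zeroE.
by rewrite !mul_mx_scalar.
Qed.

Lemma four_form_sqr l a b d :
  let x := row_mx (row_mx l a) (row_mx b d) in
  sprod H x x = 2 * dotv l d + 2 * dotv a a + 2 * dotv b b + 2 * dotv (a *m K) b.
Proof.
have dZ (t : R) (y z : 'rV[R]_k) : dotv (t *: y) z = t * dotv y z.
  by rewrite /dotv -scalemxAl mxE.
have dr (m n : nat) (y z : 'rV[R]_m) (y' z' : 'rV[R]_n) :
    dotv (row_mx y y') (row_mx z z') = dotv y z + dotv y' z'.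
  by rewrite /dotv tr_row_mx mul_row_col mxE.
move=> x; rewrite /sprod /x four_form_mul !dr !dotvDl !dZ dotv_tr (dotvC d l); ring.
Qed.

Lemma four_form_ge0 a b d :
  0 <= sprod H (row_mx (row_mx 0 a) (row_mx b d)) (row_mx (row_mx 0 a) (row_mx b d)).
Proof.
rewrite four_form_sqr; have := dotv_ge0 (a *m K + b); have := contrK a.
have := dotv_ge0 a; have := dotv_ge0 b.
rewrite dotvDl dotvC dotvDl [dotv b (_ + _)]dotvC dotvDl (dotvC b (a *m K)).
have -> : dotv 0 d = 0 by rewrite /dotv mul0mx mxE.
lra.
Qed.

Lemma four_form_nonsingular : nonsingular_symmetric H.
Proof.
split; first by rewrite /H !tr_block_mx !trmx0 !tr_scalar_mx trmxK.
rewrite -row_free_unit -kermx_eq0; apply/rowV0P=> x /sub_kermxP.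
rewrite -[x]hsubmxK -[lsubmx x]hsubmxK -[rsubmx x]hsubmxK.
move: (lsubmx (lsubmx x)) (rsubmx (lsubmx x)) (lsubmx (rsubmx x)) (rsubmx (rsubmx x)).
move=> l a b d.
rewrite four_form_mul -[X in _ = X]row_mx0 => /eq_row_mx[].
rewrite -[X in _ = X]row_mx0 => /eq_row_mx[d0 ab].
rewrite -[X in _ = X]row_mx0 => /eq_row_mx[ba l0].
have dZ (t : R) (y z : 'rV[R]_k) : dotv (t *: y) z = t * dotv y z.
  by rewrite /dotv -scalemxAl mxE.
have d00 (y : 'rV[R]_k) : dotv 0 y = 0 by rewrite /dotv mul0mx mxE.
have := congr1 (fun y => dotv y a) ab; have := congr1 (fun y => dotv y b) ba.
rewrite !dotvDl !dZ !d00 dotv_tr => hb ha.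
have := dotv_ge0 (a *m K + b); have := contrK a; have := dotv_ge0 a; have := dotv_ge0 b.
rewrite dotvDl dotvC dotvDl [dotv b (_ + _)]dotvC dotvDl (dotvC b (a *m K)) => h1 h2 h3 h4.
have /eqP : dotv a a = 0 by lra.
have /eqP : dotv b b = 0 by lra.
by rewrite !dotv_eq0 => /eqP -> /eqP ->; rewrite d0 l0 !row_mx0.
Qed.

Lemma four_rank : space_rank H = k.
Proof.
pose U : 'M[R]_(k, (k + k) + (k + k)) := row_mx 0 (row_mx 0 1%:M).
pose W : 'M[R]_(k + (k + k), (k + k) + (k + k)) := block_mx (row_mx 0 1%:M) 0 0 1%:M.
have rU : \rank U = k by rewrite rank_row_0mx rank_row_0mx mxrank1.
have rW : \rank W = (k + (k + k))%N by rewrite rank_diag_block_mx rank_row_0mx !mxrank1.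
rewrite (space_rankP four_form_nonsingular (U := U) (W := W)) ?rU ?rW //.
- move=> x /submxP[u ->].
  rewrite mul_mx_row mulmx0 mul_mx_row mulmx0 mulmx1 -(row_mx0 _ 1 k k) four_form_sqr.
  by rewrite /dotv !mul0mx mxE; ring.
- move=> x /submxP[u ->]; rewrite -[u]hsubmxK -[rsubmx u]hsubmxK.
  rewrite mul_row_block mulmx0 addr0 mulmx0 add0r mulmx1 mul_mx_row mulmx0 mulmx1.
  exact: four_form_ge0.
- by lia.
Qed.

Lemma four_is_adjoint : hadj H N = M.
Proof.
have [_ uH] := four_form_nonsingular; rewrite /hadj; apply: (canLR (mulmxK uH)).
rewrite /H /N /M !tr_block_mx !trmx0 !trmx1 !tr_scalar_mx.
by rewrite !(mulmx_block, add_block_mx, zeroE).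
Qed.

Lemma four_mulC : N *m M = M *m N.
Proof. by rewrite /N /M !(mulmx_block, add_block_mx, zeroE, block_mx0). Qed.

Lemma four_sqr : N *m N = block_mx 0 (block_mx 0 K 0 0) 0 0.
Proof. by rewrite /N !(mulmx_block, add_block_mx, zeroE, block_mx0). Qed.

Lemma four_mul : N *m M = block_mx 0 (block_mx 0 2%:M 0 0) 0 0.
Proof. by rewrite /N /M !(mulmx_block, add_block_mx, zeroE, block_mx0). Qed.

Lemma four_idempotent (E : 'M[R]_((k + k) + (k + k))) :
  (forall e : 'M[R]_k, e *m K = K *m e -> e *m e = e -> e = 0 \/ e = 1%:M) ->
  E *m E = E -> E *m N = N *m E -> E *m M = M *m E -> E = 0 \/ E = 1%:M.
Proof.
move=> idK EE EN EM.
have ENM : E *m (N *m M) = (N *m M) *m E by rewrite mulmxA EN -!mulmxA EM.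
have ENN : E *m (N *m N) = (N *m N) *m E by rewrite mulmxA EN -!mulmxA EN.
move: EE EN EM ENM ENN; rewrite four_mul four_sqr -[E]submxK.
rewrite -[ulsubmx E]submxK -[ursubmx E]submxK -[dlsubmx E]submxK -[drsubmx E]submxK.
move: (ulsubmx (ulsubmx E)) (ursubmx (ulsubmx E)) (dlsubmx (ulsubmx E)) (drsubmx (ulsubmx E)).
move: (ulsubmx (ursubmx E)) (ursubmx (ursubmx E)) (dlsubmx (ursubmx E)) (drsubmx (ursubmx E)).
move: (ulsubmx (dlsubmx E)) (ursubmx (dlsubmx E)) (dlsubmx (dlsubmx E)) (drsubmx (dlsubmx E)).
move: (ulsubmx (drsubmx E)) (ursubmx (drsubmx E)) (dlsubmx (drsubmx E)) (drsubmx (drsubmx E)).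
move=> e22 e23 e32 e33 e20 e21 e30 e31 e02 e03 e12 e13 e00 e01 e10 e11.
rewrite /N /M !(mulmx_block, add_block_mx, zeroE).
move=> EE EN EM ENM ENN.
have two (A B : 'M[R]_k) : A *m 2%:M = 2%:M *m B -> A = B.
  by rewrite mul_mx_scalar mul_scalar_mx; apply: scalerI; rewrite pnatr_eq0.
have two0 (A : 'M[R]_k) : A *m 2%:M = 0 -> A = 0.
  by move=> A0; apply: two; rewrite mulmx0.
have two0' (A : 'M[R]_k) : 0 = 2%:M *m A -> A = 0.
  by move=> A0; apply/esym/two; rewrite mul0mx.
have z4 : 0 = block_mx 0 0 0 0 :> 'M[R]_(k + k) by rewrite block_mx0.
case/eq_block_mx: ENM; rewrite [LHS in LHS = _ -> _]z4 [X in _ -> _ -> _ -> _ = X -> _]z4.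
move=> /eq_block_mx[/two0' e30_0 /two0' e31_0 _ _].
move=> /eq_block_mx[/two0' e32_0 /two e33E _ /two0 e10_0] _ /eq_block_mx[_ /two0 e20_0 _ _].
case/eq_block_mx: ENN => _ /eq_block_mx[_ eK _ _] _ _.
case/eq_block_mx: EN => /eq_block_mx[_ e11E _ _] /eq_block_mx[e12_0 _ _ _] _ _.
case/eq_block_mx: EM; rewrite [LHS in LHS = _ -> _]z4.
move=> /eq_block_mx[_ e21_0 _ _] /eq_block_mx[e22E _ _ _] _ _.
move: EE; rewrite -e33E -e11E -e12_0 -e21_0 -e22E e10_0 e20_0 e30_0 e31_0 e32_0 !zeroE.
case/eq_block_mx=> /eq_block_mx[ee E01 _ _] /eq_block_mx[E02 E03 _ E13] _ /eq_block_mx[_ E23 _ _].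
rewrite -e33E in eK.
have dbl (A : 'M[R]_k) : A + A = A -> A = 0.
  by move/eqP; rewrite -[X in _ == X]addr0 (inj_eq (addrI _)) => /eqP.
have [e0|e1] := idK e00 eK ee; [left|right].
  rewrite e0 !zeroE in E01 E02 E13 E23.
  rewrite e0 -E01 -E02 !zeroE in E03.
  by rewrite e0 -E01 -E02 -E03 -E13 -E23 !block_mx0.
rewrite e1 !zeroE in E01 E02 E13 E23.
rewrite e1 (dbl _ E01) (dbl _ E02) !zeroE in E03.
rewrite e1 (dbl _ E01) (dbl _ E02) (dbl _ E03) (dbl _ E13) (dbl _ E23).
by rewrite !block_mx0 -!scalar_mx_block.
Qed.

Lemma four_indecomposable :
  (forall e : 'M[R]_k, e *m K = K *m e -> e *m e = e -> e = 0 \/ e = 1%:M) ->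
  indecomposable_normal k H N.
Proof.
move=> idK; have nH := four_form_nonsingular; split=> //; first exact: four_rank.
  exists M; last exact: four_mulC.
  by apply/(is_adjointE _ _ nH); exact/esym/four_is_adjoint.
apply: indecomposable_criterion => // E EE EN; rewrite four_is_adjoint => EM _.
exact: four_idempotent.
Qed.

Lemma four_cube : N *m (N *m N) = 0.
Proof. by rewrite four_sqr /N !(mulmx_block, add_block_mx, zeroE, block_mx0). Qed.

End FourBlocks.

Lemma shift_contraction (R : realType) n (C : 'M[R]_n.+1) :
  char_poly C = 'X^(n.+1) ->
  (forall i : 'I_n.+1, delta_mx 0 0 *m C ^+ i = delta_mx 0 i :> 'rV_n.+1) ->
  forall a : 'rV[R]_n.+1, dotv (a *m C) (a *m C) <= dotv a a.
Proof.
move=> cC CS a; have Cn : C ^+ n.+1 = 0.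
  by rewrite -[RHS](Cayley_Hamilton C) cC rmorphXn /= horner_mx_X.
have CE i j : C i j = (i.+1 == j)%:R.
  have -> : C i j = (delta_mx 0 0 *m C ^+ i.+1 : 'rV_n.+1) 0 j.
    by rewrite exprSr [_ *m (_ * _)]mulmxA CS -rowE mxE.
  have [ilt|ige] := ltnP i.+1 n.+1.
    by rewrite (CS (Ordinal ilt)) mxE eqxx /= eq_sym.
  have -> : i.+1 = n.+1 by have := ltn_ord i; lia.
  by rewrite Cn mulmx0 mxE gtn_eqF.
have aC0 : (a *m C) 0 0 = 0.
  by rewrite mxE big1 // => i _; rewrite CE mulr0.
have aCS (j : 'I_n) : (a *m C) 0 (lift ord0 j) = a 0 (widen_ord (leqnSn n) j).
  rewrite mxE (bigD1 (widen_ord (leqnSn n) j)) //= CE /= eqxx mulr1 big1 ?addr0 // => i ij.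
  rewrite CE /= /bump leq0n add1n eqSS (_ : (i == j :> nat) = false) ?mulr0 //.
  by apply: contraNF ij => /eqP ij; apply/eqP/val_inj.
have dE (x : 'rV[R]_n.+1) : dotv x x = \sum_i x 0 i ^+ 2.
  by rewrite /dotv mxE; apply: eq_bigr => i _; rewrite [x^T _ _]mxE expr2.
rewrite !dE big_ord_recl [leRHS]big_ord_recr /= aC0 expr0n add0r.
under eq_bigr do rewrite aCS.
by rewrite lerDl sqr_ge0.
Qed.

Lemma one_real_eigenvalue_4k (R : realType) k : (0 < k)%N ->
  attained k (@one_real_eigenvalue R (4 * k)).
Proof.
have -> : (4 * k = (k + k) + (k + k))%N by lia.
case: k => // k _.
have [|C [cC CS]] := @companion R k 'X^(k.+1) (monicXn _ _); first exact: size_polyXn.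
have contrC := shift_contraction cC CS.
exists (four_form C), (four_mx C); split.
  apply: four_indecomposable => // e eC ee.
  have pX : prime_like ('X : {poly R}) by rewrite -[X in prime_like X]subr0; exact: prime_like_XsubC.
  exact: (cyclic_idempotent cC CS pX (erefl _) eC ee).
set N := four_mx C; have N3 : horner_mx N (conj_poly 0 ^+ 2) = 0.
  have -> : conj_poly (0 : R[i]) = 'X^2.
    by rewrite /conj_poly /= mulr0 scale0r subr0 expr0n addr0 addr0.
  rewrite -exprM rmorphXn /= horner_mx_X exprS (_ : N ^+ 3 = 0) ?mulr0 //.
  exact: (four_cube C).
have [l Nl] := exists_complex_eigenvalue N; exists 0 => z.
have l0 : l = 0.
  have := eigenvalue_annihilator N3 Nl; rewrite rmorphXn /= /root horner_exp expf_eq0 /=.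
  by rewrite -[_ == 0]/(root _ _) root_toC_conj_poly conjc0 orbb => /eqP.
by rewrite l0 in Nl; rewrite (annihilated_pair Nl N3) !inE conjc0 orbb.
Qed.

Local Close Scope ring_scope.

Theorem theorem2 (R : realType) (k : nat) (k_gt0 : (0 < k)%N) :
  (forall (n : nat) (H N : 'M[R]_n), indecomposable_normal k H N ->
     ((one_real_eigenvalue N /\ (2 * k <= n <= 4 * k)%N)
      \/ (two_real_eigenvalues N /\ n = (2 * k)%N)
      \/ (one_nonreal_pair N /\
          (k = 1%N -> n = 2%N) /\
          ((1 < k)%N -> (2 * k <= n <= 10 * k./2 - 2)%N))
      \/ (one_real_one_nonreal_pair N /\ n = (2 * k)%N)
      \/ (two_nonreal_pairs N /\ n = (2 * k)%N))
     /\ (one_real_one_nonreal_pair N -> ~~ odd k)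
     /\ (two_nonreal_pairs N -> ~~ odd k))
  /\ attained k (@one_real_eigenvalue R (2 * k))
  /\ attained k (@one_real_eigenvalue R (4 * k))
  /\ attained k (@two_real_eigenvalues R (2 * k))
  /\ attained k (@one_nonreal_pair R (2 * k))
  /\ (~~ odd k -> attained k (@one_real_one_nonreal_pair R (2 * k)))
  /\ (~~ odd k -> attained k (@two_nonreal_pairs R (2 * k))).
Proof.
split; last first.
  split; first exact: one_real_eigenvalue_2k.
  split; first exact: one_real_eigenvalue_4k.
  split; first exact: two_real_eigenvalues_2k.
  split; first exact: one_nonreal_pair_2k.
  split; first exact: one_real_one_nonreal_pair_2k.
  exact: two_nonreal_pairs_2k.
move=> [|n] H N [nH rk norN iN].
  by move: (space_rank_le nH); rewrite rk; case: (k) k_gt0.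
subst k; exact: classification nH iN norN k_gt0.
Qed.
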